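(* For every $n\ge2$, $\mathrm{GC}(K_n,d_K)\ge 2n$.
   Context: Let $e_i$ be the $i$-th standard unit vector of $\mathbb R^n$. Let $\sim$ be the equivalence relation on $\mathbb R^n$ generated by $x\sim x+e_i$ for $1\le i\le n-1$ and $(x_1,\ldots,x_{n-1},x_n)\sim(1-x_1,\ldots,1-x_{n-1},x_n+1)$; $K_n=\mathbb R^n/\sim$ with quotient map $p$ and flat metric $d_K(y,y')=\min\{d(x,x'):x\in p^{-1}(y),x'\in p^{-1}(y')\}$, $d$ Euclidean. For a metric space $X$, $GX$ denotes the space of minimal geodesics (paths $\gamma:[0,1]\to X$ of length $d(\gamma(0),\gamma(1))$, compact-open topology) and $\pi:GX\to X\times X$ the endpoint map. $\mathrm{GC}(X,d)$ is the smallest $k$ such that $X\times X$ is a disjoint union of $k+1$ ENRs $E_0,\dots,E_k$ each admitting a continuous section $E_i\to GX$ of $\pi$. *)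

(* Defs.v *)
From Stdlib Require Import Reals Lra Relations ClassicalEpsilon.
Open Scope R_scope.

(** Vectors: [nat -> R]; a point of R^m is a vector vanishing at indices >= m.
    Coordinates x_1..x_n of the paper are indices 0..n-1 here. *)
Definition vec := nat -> R.

Definition inRn (m : nat) (x : vec) : Prop := forall i, (m <= i)%nat -> x i = 0.

Fixpoint sumR (k : nat) (f : nat -> R) : R :=
  match k with O => 0 | S j => sumR j f + f j end.

Definition euclid (m : nat) (x y : vec) : R :=
  sqrt (sumR m (fun i => (x i - y i) ^ 2)).

Definition unit_vec (i : nat) : vec := fun j => if Nat.eqb i j then 1 else 0.

Definition glide (n : nat) (x : vec) : vec :=
  fun j => if Nat.ltb j (n - 1) then 1 - x j
           else if Nat.eqb j (n - 1) then x j + 1 else x j.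

Inductive Kstep (n : nat) : vec -> vec -> Prop :=
| Kstep_tr : forall x i, (i < n - 1)%nat -> Kstep n x (fun j => x j + unit_vec i j)
| Kstep_gl : forall x, Kstep n x (glide n x).

(** The equivalence relation ~ generated by the steps; K_n = R^n / ~. *)
Definition Kequiv (n : nat) : vec -> vec -> Prop := clos_refl_sym_trans vec (Kstep n).

Definition is_dK (n : nat) (x y : vec) (r : R) : Prop :=
  (exists x1 y1, inRn n x1 /\ inRn n y1 /\ Kequiv n x x1 /\ Kequiv n y y1 /\
                 euclid n x1 y1 = r) /\
  (forall x1 y1, inRn n x1 -> inRn n y1 -> Kequiv n x x1 -> Kequiv n y y1 ->
                 r <= euclid n x1 y1).

Definition dK (n : nat) (x y : vec) : R := epsilon (inhabits 0) (is_dK n x y).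

(** Metric on K_n x K_n (induces the product topology). *)
Definition dKK (n : nat) (p q : vec * vec) : R := dK n (fst p) (fst q) + dK n (snd p) (snd q).

Definition inKK (n : nat) (p : vec * vec) : Prop := inRn n (fst p) /\ inRn n (snd p).

Definition openK (n : nat) (V : vec -> Prop) : Prop :=
  forall z, inRn n z -> V z ->
    exists eps, 0 < eps /\ forall w, inRn n w -> dK n z w < eps -> V w.

Definition Kpath (n : nat) (g : R -> vec) : Prop :=
  (forall t, 0 <= t <= 1 -> inRn n (g t)) /\
  (forall t, 0 <= t <= 1 -> forall eps, 0 < eps ->
     exists delta, 0 < delta /\
       forall s, 0 <= s <= 1 -> Rabs (t - s) < delta -> dK n (g t) (g s) < eps).

Definition partition_sums (n : nat) (g : R -> vec) (v : R) : Prop :=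
  exists (k : nat) (t : nat -> R),
    t O = 0 /\ t k = 1 /\ (forall i, (i < k)%nat -> t i <= t (S i)) /\
    v = sumR k (fun i => dK n (g (t i)) (g (t (S i)))).

Definition min_geod (n : nat) (g : R -> vec) : Prop :=
  Kpath n g /\ is_lub (partition_sums n g) (dK n (g 0) (g 1)).

(** s : E -> GK_n is a continuous section of the endpoint map,
    GK_n carrying the (subspace of the) compact-open topology. *)
Definition cont_section (n : nat) (E : vec * vec -> Prop) (s : vec * vec -> R -> vec) : Prop :=
  (forall p, inKK n p -> E p ->
     min_geod n (s p) /\ Kequiv n (s p 0) (fst p) /\ Kequiv n (s p 1) (snd p)) /\
  (forall (C : R -> Prop) (V : vec -> Prop),
     compact C -> (forall t, C t -> 0 <= t <= 1) -> openK n V ->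
     forall p, inKK n p -> E p -> (forall t, C t -> V (s p t)) ->
       exists delta, 0 < delta /\
         forall q, inKK n q -> E q -> dKK n p q < delta -> forall t, C t -> V (s q t)).

(** E (a subset of K_n x K_n) is an ENR: homeomorphic (via h, with inverse g)
    to a subset A of some R^m which is a retract (via r) of an open U ⊇ A. *)
Definition ENR (n : nat) (E : vec * vec -> Prop) : Prop :=
  exists (m : nat) (h : vec * vec -> vec) (g : vec -> vec * vec)
         (U : vec -> Prop) (r : vec -> vec),
    let A := fun a => exists p, inKK n p /\ E p /\ a = h p in
    (forall p, inKK n p -> E p -> inRn m (h p)) /\
    (forall p, inKK n p -> E p -> forall eps, 0 < eps -> exists delta, 0 < delta /\
       forall q, inKK n q -> E q -> dKK n p q < delta -> euclid m (h p) (h q) < eps) /\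
    (forall a, A a -> inKK n (g a) /\ E (g a) /\ h (g a) = a) /\
    (forall p, inKK n p -> E p ->
       Kequiv n (fst (g (h p))) (fst p) /\ Kequiv n (snd (g (h p))) (snd p)) /\
    (forall a, A a -> forall eps, 0 < eps -> exists delta, 0 < delta /\
       forall b, A b -> euclid m a b < delta -> dKK n (g a) (g b) < eps) /\
    (forall a, A a -> U a) /\
    (forall u, U u -> inRn m u) /\
    (forall u, U u -> exists eps, 0 < eps /\
       forall v, inRn m v -> euclid m u v < eps -> U v) /\
    (forall u, U u -> A (r u)) /\
    (forall a, A a -> r a = a) /\
    (forall u, U u -> forall eps, 0 < eps -> exists delta, 0 < delta /\
       forall v, U v -> euclid m u v < delta -> euclid m (r u) (r v) < eps).

Definition GC_decomposition (n k : nat) (E : nat -> vec * vec -> Prop) : Prop :=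
  (forall i p q, (i <= k)%nat -> inKK n p -> inKK n q ->
     Kequiv n (fst p) (fst q) -> Kequiv n (snd p) (snd q) -> E i p -> E i q) /\
  (forall p, inKK n p -> exists i, (i <= k)%nat /\ E i p) /\
  (forall i j p, (i <= k)%nat -> (j <= k)%nat -> inKK n p -> E i p -> E j p -> i = j) /\
  (forall i, (i <= k)%nat -> ENR n (E i)) /\
  (forall i, (i <= k)%nat -> exists s, cont_section n (E i) s).

(* Main.v *)
(** Write m = n - 1 and, for (x, y) in K_n x K_n, u = x' - y', w = x' + y' (first m coordinates)
    and t = x_n - y_n.  The points of the orbit of y split into the translates (y' + v, y_n + 2a)
    and the reflected translates (v - y', y_n + 2a + 1), so the squared distance is
    min (dist(u, Z^m)^2 + dist(t, 2Z)^2, dist(w, Z^m)^2 + dist(t - 1, 2Z)^2).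
    On the circle u = w = (1/2, ..., 1/2), t = 1/2 the minimal geodesics correspond to the
    vertices of two m-cubes, one for u and one for w, and nearby the minimal geodesics are those of
    a face of the join of the two cubes, a polytope of dimension 2m + 1.  Locally this only forces
    2m + 2 pieces; but going once around the circle acts antipodally on both cubes.

    A continuous section on E_i is a locally constant choice of vertex.  By a Lebesgue
    number argument the pieces and choices are encoded on the vertices of a fine triangulation of
    the (2m + 2)-dimensional neighbourhood of the circle: each vertex gets a label i and a cube
    vertex, and adjacent vertices with the same label get the same cube vertex.  With at most
    2m + 2 labels, a mod 2 cochain evaluated on the label-ordered simplices is automatically
    closed in top degree, so its count over a slice of the neighbourhood does not change along the
    circle.  The join omega of the cup products of the coboundaries of the m vertex bits counts 1
    on each slice (Sperner's lemma, by descent through faces).  But omega = omega0 + A omega0,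
    where A is the antipodal map and omega0 fixes the first bit, and the monodromy identifies the
    counts of omega0 and A omega0.  Hence omega counts 0, a contradiction. *)

Require Import Defs.
From Stdlib Require Import Reals Lra Lia ZArith Relations ClassicalEpsilon FunctionalExtensionality Arith.
From mathcomp Require all_boot zify.

(** * A twisted Sperner lemma modulo 2 *)

Module Comb.
Import all_boot zify.
Local Open Scope nat_scope.
Set Implicit Arguments. Unset Strict Implicit. Unset Printing Implicit Defensive.

Local Notation "\xor_ ( i <- r ) F" := (\big[addb/false]_(i <- r) F)
  (at level 41, F at level 41, i, r at level 50).

(* The mod 2 coboundary, augmented: [del phi [:: x] = phi [::]]. *)
Fixpoint del {T : Type} (phi : seq T -> bool) (l : seq T) : bool :=
  if l is x :: l' then phi l' (+) del (fun r => phi (x :: r)) l' else false.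

Lemma del_map (T T' : Type) (f : T -> T') (phi : seq T' -> bool) l :
  del (fun r => phi (map f r)) l = del phi (map f l).
Proof. by elim: l phi => //= x l IH phi; rewrite (IH (fun r => phi (f x :: r))). Qed.

Lemma del_false (T : Type) (l : seq T) : del (fun _ => false) l = false.
Proof. by elim: l. Qed.

Lemma eq_del (T : eqType) (phi psi : seq T -> bool) l :
  (forall r, subseq r l -> phi r = psi r) -> del phi l = del psi l.
Proof.
elim: l phi psi => //= x l IH phi psi H; congr (_ (+) _).
- by apply: H; exact: subseq_cons.
- by apply: IH => r Hr; apply: H; rewrite /= eqxx.
Qed.

(** If a cochain ignores the order of vertices, so does its coboundary; this form makes that visible
    for [del_lift]. *)
Lemma del_rem (T : eqType) (phi : seq T -> bool) l :
  (forall r r', perm_eq r r' -> phi r = phi r') ->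
  del phi l = \xor_(p <- l) phi (rem p l).
Proof.
elim: l phi => [|x l IH] phi H /=; first by rewrite big_nil.
rewrite big_cons eqxx; congr (_ (+) _).
rewrite IH; last by move=> r r' E; apply: H; rewrite perm_cons.
apply: eq_big_seq => p pl; case: (eqVneq x p) => [->|//].
by apply: H; rewrite perm_sym; exact: perm_to_rem.
Qed.

Lemma sum_sym (T : eqType) (G : T -> T -> bool) (S : seq T) :
  (forall i j, G i j = G j i) -> (forall i, G i i = false) ->
  \xor_(j <- S) \xor_(i <- S) G j i = false.
Proof.
move=> Gs G0; elim: S => [|x S IH]; first by rewrite big_nil.
rewrite big_cons big_cons G0 /=.
under [X in _ (+) X]eq_bigr => j _ do rewrite big_cons.
rewrite big_split /= IH addbF.
by under [X in _ (+) X]eq_bigr => j _ do rewrite Gs; rewrite addbb.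
Qed.

(** * Triangulation of a cube by monotone paths *)

Definition upd (b : nat -> nat) (j v : nat) : nat -> nat :=
  fun i => if i == j then v else b i.

Lemma updC b i j x y : i != j -> upd (upd b i x) j y = upd (upd b j y) i x.
Proof.
move=> ij; apply: functional_extensionality => k; rewrite /upd.
by case: (eqVneq k j) => [->|//]; rewrite eq_sym (negbTE ij).
Qed.

Lemma updK b i x y : upd (upd b i x) i y = upd b i y.
Proof. by apply: functional_extensionality => k; rewrite /upd; case: eqVneq. Qed.

Definition dels (j : nat) (S : seq nat) := [seq i <- S | i != j].

Lemma delsC i j S : dels i (dels j S) = dels j (dels i S).
Proof. by rewrite /dels -!filter_predI; apply: eq_filter => k /=; rewrite andbC. Qed.

Lemma dels_uniq j S : uniq S -> uniq (dels j S).
Proof. exact: filter_uniq. Qed.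

Lemma mem_dels i j S : (i \in dels j S) = (i != j) && (i \in S).
Proof. by rewrite mem_filter. Qed.

Lemma size_dels j S k : uniq S -> j \in S -> size S = k.+1 -> size (dels j S) = k.
Proof. by move=> uS jS sS; rewrite /dels -rem_filter // size_rem // sS. Qed.

(* Mod 2 sum of [phi] over the simplices of the cube spanned by [b] and [e] in the
   directions [S], one for each monotone path from [b] to [e]; [k] is the length of [S]. *)
Fixpoint paths (k : nat) (S : seq nat) (b e : nat -> nat)
    (phi : seq (nat -> nat) -> bool) : bool :=
  if k is k'.+1 then
    \xor_(j <- S) paths k' (dels j S) (upd b j (e j)) e (fun l => phi (b :: l))
  else phi [:: b].

Lemma pathsS k S b e phi : paths k.+1 S b e phi =
  \xor_(j <- S) paths k (dels j S) (upd b j (e j)) e (fun l => phi (b :: l)).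
Proof. by []. Qed.

Lemma paths_add k S b e phi psi :
  paths k S b e (fun l => phi l (+) psi l) = paths k S b e phi (+) paths k S b e psi.
Proof.
elim: k S b phi psi => //= k IH S b phi psi.
by rewrite -big_split /=; apply: eq_bigr => j _; exact: IH.
Qed.

(** Stokes' formula on one cube. A face omitting a middle vertex lies on two paths, which differ by
    swapping two consecutive steps, so it cancels modulo 2. Dropping the last or the first vertex
    leaves the paths of the two facets in direction [j]. *)
Lemma paths_del k S b e phi : uniq S -> size S = k.+1 ->
  paths k.+1 S b e (del phi) =
  \xor_(j <- S) (paths k (dels j S) b e phi
                 (+) paths k (dels j S) (upd b j (e j)) e phi).
Proof.
elim: k S b phi => [|k IH] S b phi uS sS.
  by apply: eq_bigr => j _ /=; rewrite addbF addbC.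
rewrite pathsS.
under eq_bigr => j _ do rewrite (paths_add k.+1 _ _ _ phi (del (fun r => phi (b :: r)))).
rewrite big_split [RHS]big_split /= addbC; congr (_ (+) _).
have step : \xor_(j <- S) paths k.+1 (dels j S) (upd b j (e j)) e (del (fun r => phi (b :: r)))
  = \xor_(j <- S) \xor_(i <- dels j S)
     (paths k (dels i (dels j S)) (upd b j (e j)) e (fun r => phi (b :: r)) (+)
      paths k (dels i (dels j S)) (upd (upd b j (e j)) i (e i)) e (fun r => phi (b :: r))).
  apply: eq_big_seq => j jS; rewrite IH //; first exact: dels_uniq.
  exact: size_dels sS.
rewrite [LHS]step.
under eq_bigr => j _ do rewrite big_split.
rewrite big_split /= [X in _ (+) X](_ : _ = false) ?addbF; last first.
  (* Terms in which both [j] and [i] have been moved are symmetric in the two directions and cancel;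
     the diagonal is filled with [false]. *)
  pose G j i := if i != j then
     paths k (dels i (dels j S)) (upd (upd b j (e j)) i (e i)) e (fun r => phi (b :: r))
     else false.
  transitivity (\xor_(j <- S) \xor_(i <- S) G j i).
    by apply: eq_bigr => j _; rewrite big_filter big_mkcond.
  apply: sum_sym => [i j|i]; last by rewrite /G eqxx.
  rewrite /G eq_sym; case: eqVneq => [//|ij] /=.
  by rewrite delsC updC // eq_sym.
transitivity (\xor_(j <- S) \xor_(i <- S) (if i != j then
     paths k (dels i (dels j S)) (upd b j (e j)) e (fun r => phi (b :: r)) else false)).
  by apply: eq_bigr => j _; rewrite big_filter big_mkcond.
rewrite exchange_big /=; apply: eq_bigr => i _.
rewrite [RHS]big_filter [RHS]big_mkcond; apply: eq_bigr => j _.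
by rewrite eq_sym; case: ifP => // _; rewrite delsC.
Qed.

Lemma eq_paths_end k S b e e' phi :
  {in S, e =1 e'} -> paths k S b e phi = paths k S b e' phi.
Proof.
elim: k S b phi => //= k IH S b phi ee; apply: eq_big_seq => j jS.
rewrite ee //; apply: IH => i; rewrite mem_dels => /andP[_]; exact: ee.
Qed.

Fixpoint allp (T : Type) (P : T -> Prop) (l : seq T) : Prop :=
  if l is x :: l' then P x /\ allp P l' else True.

Lemma eq_paths k S b e b0 (phi psi : seq (nat -> nat) -> bool) :
  (forall i, b i = b0 i \/ b i = e i) ->
  (forall l, size l = k.+1 -> allp (fun x => forall i, x i = b0 i \/ x i = e i) l ->
     phi l = psi l) ->
  paths k S b e phi = paths k S b e psi.
Proof.
elim: k S b phi psi => [|k IH] S b phi psi Hb H /=; first by apply: H.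
apply: eq_bigr => j _; apply: IH => [i|l sl Hl].
  by rewrite /upd; case: eqVneq => [->|_]; [right|].
by apply: H => //=; rewrite sl.
Qed.

(* Every unit cube is triangulated by the paths from its corner with odd coordinates to its
   corner with even coordinates (the Union Jack triangulation): unlike the one with all paths
   in the positive direction, it is invariant under the reflections [x_j -> N - x_j], [N] even. *)
Definition oddc (c : nat) := if odd c then c else c.+1.
Definition evenc (c : nat) := if odd c then c.+1 else c.

(** * Summation over the triangulated grid *)

Fixpoint cells (N : nat) (S : seq nat) (b e : nat -> nat)
    (F : (nat -> nat) -> (nat -> nat) -> bool) : bool :=
  if S is j :: S' then
    \xor_(c <- index_iota 0 N) cells N S' (upd b j (oddc c)) (upd e j (evenc c)) F
  else F b e.

Lemma cells_sum N S b e (r : seq nat) F :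
  cells N S b e (fun b e => \xor_(j <- r) F j b e) = \xor_(j <- r) cells N S b e (F j).
Proof.
elim: S b e => //= i S IH b e; under eq_bigr => c _ do rewrite IH.
by rewrite exchange_big.
Qed.

Lemma cells_add N S b e F G :
  cells N S b e (fun b e => F b e (+) G b e) = cells N S b e F (+) cells N S b e G.
Proof.
by elim: S b e => //= i S IH b e; under eq_bigr => c _ do rewrite IH; rewrite big_split.
Qed.

Lemma cells_extract N S j b e F : uniq S -> j \in S ->
  cells N S b e F =
  \xor_(c <- index_iota 0 N) cells N (dels j S) (upd b j (oddc c)) (upd e j (evenc c)) F.
Proof.
elim: S b e => //= i S IH b e /andP[iS uS]; rewrite inE; case: eqVneq => [-> _|ij /= jS].
  suff -> : dels i S = S by [].
  by apply/all_filterP/allP => k kS /=; apply: contraNneq iS => <-.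
under eq_bigr => c _ do rewrite IH //.
rewrite exchange_big /=; apply: eq_bigr => c _; apply: eq_bigr => d _ /=.
by rewrite ![upd (upd _ i _) j _]updC // eq_sym.
Qed.

Lemma cells_rel (R : (nat -> nat) -> (nat -> nat) -> (nat -> nat) -> (nat -> nat) -> Prop)
    N S b e b' e' (F F' : (nat -> nat) -> (nat -> nat) -> bool) :
  (forall j c b e b' e', j \in S -> c < N -> R b e b' e' ->
     R (upd b j (oddc c)) (upd e j (evenc c)) (upd b' j (oddc c)) (upd e' j (evenc c))) ->
  R b e b' e' -> (forall b e b' e', R b e b' e' -> F b e = F' b' e') ->
  cells N S b e F = cells N S b' e' F'.
Proof.
elim: S b e b' e' => [|j S IH] b e b' e' HR R0 HF /=; first exact: HF.
apply: eq_big_seq => c; rewrite mem_index_iota => cN; apply: IH => //.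
  by move=> *; apply: HR => //; rewrite inE orbC; apply/orP; left.
by apply: HR => //; rewrite inE eqxx.
Qed.

(** The value modulo 2 of the cochain [phi] on the face of the grid through [z] spanned by the
    directions [S]. *)
Definition J N S z phi := cells N S z z (fun b e => paths (size S) S b e phi).

(** In whichever order [oddc] and [evenc] list the ends [c] and [c.+1], the sum modulo 2 is the
    same, so inner terms cancel. *)
Lemma telescope N (K : nat -> bool) :
  \xor_(c <- index_iota 0 N) (K (oddc c) (+) K (evenc c)) = K 0 (+) K N.
Proof.
elim: N => [|N IH]; first by rewrite big_nil addbb.
rewrite -/(index_iota 0 N.+1) big_nat_recr //= IH /oddc /evenc.
by case: ifP => _; case: (K 0); case: (K N); case: (K N.+1).
Qed.

(** Stokes' formula on a face of the grid: adjacent cubes triangulate their common facet alike, so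
    only the facets at [0] and [N] survive. *)
Lemma J_del N S z phi k : uniq S -> size S = k.+1 ->
  J N S z (del phi) =
  \xor_(j <- S) (J N (dels j S) (upd z j 0) phi (+) J N (dels j S) (upd z j N) phi).
Proof.
move=> uS sS; rewrite /J sS.
have -> : (fun b e => paths k.+1 S b e (del phi)) =
  (fun b e => \xor_(j <- S) (paths k (dels j S) b e phi
                 (+) paths k (dels j S) (upd b j (e j)) e phi)).
  apply: functional_extensionality => b; apply: functional_extensionality => e.
  exact: paths_del.
rewrite cells_sum; apply: eq_big_seq => j jS.
rewrite (cells_extract _ _ _ _ uS jS).
pose K v := J N (dels j S) (upd z j v) phi.
rewrite -[RHS]/(K 0 (+) K N) -telescope; apply: eq_bigr => c _; rewrite cells_add.
have jd i : i \in dels j S -> i != j by rewrite mem_dels => /andP[].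
congr (_ (+) _); rewrite /K /J (size_dels uS jS sS).
- apply: (cells_rel (R := fun b e b' e' => b = b' /\ forall i, i != j -> e i = e' i)).
  + move=> i d b e b' e' _ _ [-> ee]; split=> // l lj; rewrite /upd; case: eqP => // _; exact: ee.
  + by split=> // i ij; rewrite /upd (negbTE ij).
  + by move=> b e b' e' [-> ee]; apply: eq_paths_end => i /jd; exact: ee.
- apply: (cells_rel (R := fun b e b' e' => b' = upd b j (e j) /\ e' = e)).
  + move=> i d b e b' e' /jd ij _ [-> ->]; split=> //.
    by rewrite updC 1?eq_sym // [upd e i _ j]/upd eq_sym (negbTE ij).
  + by rewrite updK /upd eqxx; split.
  + by move=> b e b' e' [-> ->].
Qed.

(** Retains two facts about a simplex counted by [J]: its number of vertices, and that they are all
    corners of one small cube of the face. *)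
Definition good N (S : seq nat) (z : nat -> nat) (l : seq (nat -> nat)) : Prop :=
  size l = (size S).+1 /\
  exists b e : nat -> nat,
    (forall i, [/\ b i <= N, e i <= N, b i <= (e i).+1, e i <= (b i).+1 &
                 i \notin S -> b i = z i /\ e i = z i]) /\
    allp (fun x => forall i, x i = b i \/ x i = e i) l.

Lemma eq_cells N S b e F G (Q : (nat -> nat) -> (nat -> nat) -> Prop) :
  (forall j c b e, j \in S -> c < N -> Q b e -> Q (upd b j (oddc c)) (upd e j (evenc c))) ->
  Q b e -> (forall b e, Q b e -> F b e = G b e) ->
  cells N S b e F = cells N S b e G.
Proof.
move=> HQ Q0 H; apply: (cells_rel (R := fun b e b' e' => [/\ b' = b, e' = e & Q b e])).
- by move=> j c b1 e1 b2 e2 jS cN [-> -> HQ1]; split=> //; exact: HQ.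
- by [].
- by move=> b1 e1 b2 e2 [-> -> HQ1]; exact: H.
Qed.

Lemma eq_J N S z phi psi : (forall i, z i <= N) ->
  (forall l, good N S z l -> phi l = psi l) -> J N S z phi = J N S z psi.
Proof.
move=> zN H.
apply: (eq_cells (Q := fun b e => forall i, [/\ b i <= N, e i <= N, b i <= (e i).+1,
   e i <= (b i).+1 & i \notin S -> b i = z i /\ e i = z i])).
- move=> j c b e jS cN HQ i; rewrite /upd; case: eqVneq => [->|_]; last exact: HQ.
  by rewrite jS /oddc /evenc; case: ifP => _; split=> //; lia.
- by move=> i; split.
- move=> b e HQ; apply: (@eq_paths _ _ _ _ b); first by move=> i; left.
  by move=> l sl Hl; apply: H; split=> //; exists b, e.
Qed.

Lemma J_false N S z : J N S z (fun _ => false) = false.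
Proof.
have P0 k S' b e : paths k S' b e (fun _ => false) = false.
  by elim: k S' b => //= k IH S' b; rewrite big1.
rewrite /J; move: (size S) => k.
suff C S' b e : cells N S' b e (fun b e => paths k S b e (fun _ => false)) = false by [].
by elim: S' b e => [|j S' IH] b e /=; [exact: P0|rewrite big1].
Qed.

Lemma J_eq0 N S z phi : (forall i, z i <= N) ->
  (forall l, good N S z l -> phi l = false) -> J N S z phi = false.
Proof. by move=> zN H; rewrite (eq_J zN H) J_false. Qed.

Lemma J_add N S z phi psi :
  J N S z (fun l => phi l (+) psi l) = J N S z phi (+) J N S z psi.
Proof.
rewrite /J -cells_add; congr cells.
apply: functional_extensionality => b; apply: functional_extensionality => e.
exact: paths_add.
Qed.

(** For even [N] the map [v -> N - v] preserves parity, so odd corners go to odd corners and even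
    ones to even ones: the triangulation is carried to itself. *)
Lemma J_reflect N S z phi (rf : (nat -> nat) -> nat -> nat) (rho : nat -> bool) :
  ~~ odd N ->
  (forall b j v, j \in S -> rf (upd b j v) = upd (rf b) j (if rho j then N - v else v)) ->
  J N S z (fun l => phi (map rf l)) = J N S (rf z) phi.
Proof.
move=> oN Hrf.
have P k S' b e e' : {subset S' <= S} ->
    (forall j, j \in S -> e' j = if rho j then N - e j else e j) ->
    paths k S' b e (fun l => phi (map rf l)) = paths k S' (rf b) e' phi.
  move=> sS He.
  elim: k S' b phi sS => [|k IH] S' b psi sS //=; apply: eq_big_seq => j jS.
  rewrite (IH _ _ (fun l => psi (rf b :: l))); last first.
    by move=> i; rewrite mem_dels => /andP[_]; exact: sS.
  by rewrite Hrf ?sS // He ?sS.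
rewrite /J.
move: (size S) => k.
suff C S' b e e' : {subset S' <= S} ->
   (forall j, j \in S -> j \notin S' -> e' j = if rho j then N - e j else e j) ->
  cells N S' b e (fun b e => paths k S b e (fun l => phi (map rf l))) =
  cells N S' (rf b) e' (fun b e => paths k S b e phi).
  by apply: C => // j ->.
elim: S' b e e' => [|j S' IH] b e e' sS He /=.
  by apply: P => // j jS; exact: He.
have jS : j \in S by apply: sS; rewrite inE eqxx.
have sS' : {subset S' <= S} by move=> i iS; apply: sS; rewrite inE iS orbT.
have step c : cells N S' (upd b j (oddc c)) (upd e j (evenc c))
     (fun b e => paths k S b e (fun l => phi (map rf l))) =
   cells N S' (upd (rf b) j (if rho j then N - oddc c else oddc c))
     (upd e' j (if rho j then N - evenc c else evenc c))
     (fun b e => paths k S b e phi).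
  rewrite (IH _ _ (upd e' j (if rho j then N - evenc c else evenc c))) //.
    by rewrite Hrf.
  move=> i iS iS'; rewrite /upd; case: eqVneq => [->//|ij].
  by apply: He; rewrite // inE (negbTE ij).
under eq_bigr => c _ do rewrite step.
case: (rho j) => //.
(* The reflection sends the interval starting at [c] to the one starting at [N - c.+1]; the sum is
   reindexed accordingly. *)
rewrite big_nat_rev /= big_seq [RHS]big_seq; apply: eq_bigr => c.
rewrite mem_index_iota => /andP[_ cN].
have -> : N - oddc (0 + N - c.+1) = oddc c.
  by rewrite /oddc add0n oddB // (negbTE oN) /=; case: (odd c) => /=; lia.
have -> // : N - evenc (0 + N - c.+1) = evenc c.
by rewrite /evenc add0n oddB // (negbTE oN) /=; case: (odd c) => /=; lia.
Qed.

Lemma eq_J_start N S z z' phi : (forall i, i \notin S -> z i = z' i) ->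
  J N S z phi = J N S z' phi.
Proof.
rewrite /J => H; move: (size S) => k.
suff C S' b e b' e' : (forall i, i \notin S' -> b i = b' i) ->
   (forall i, i \notin S' -> e i = e' i) ->
  cells N S' b e (fun b e => paths k S b e phi) =
  cells N S' b' e' (fun b e => paths k S b e phi).
  exact: C.
elim: S' b e b' e' => [|j S' IH] b e b' e' Hb He /=.
  by congr paths; apply: functional_extensionality => i; [apply: Hb|apply: He].
apply: eq_bigr => c _; apply: IH => i iS; rewrite /upd; case: eqVneq => // ij.
- by apply: Hb; rewrite inE negb_or ij.
- by apply: He; rewrite inE negb_or ij.
Qed.


(* The cup product of the coboundaries of the vertex bits [h], [h] in [hs]. *)
Fixpoint cup (hs : seq nat) (l : seq (seq bool)) : bool :=
  match hs, l with
  | [::], [:: _] => true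
  | h :: hs', v :: ((v' :: _) as l') => (nth false v h (+) nth false v' h) && cup hs' l'
  | _, _ => false
  end.

(** A primitive of [cup (h :: hs)]: the bit [h] itself replaces its coboundary. *)
Definition hcup h hs (l : seq (seq bool)) : bool :=
  if l is v :: _ then nth false v h && cup hs l else false.

Lemma del_cons (T : Type) (phi : seq T -> bool) x l :
  del phi (x :: l) = phi l (+) del (fun r => phi (x :: r)) l.
Proof. by []. Qed.

Lemma addb_eq (a b : bool) : a (+) b = false -> b = a.
Proof. by case: a b => -[]. Qed.

Lemma del_and (T : Type) (c : bool) (phi : seq T -> bool) l :
  del (fun r => c && phi r) l = c && del phi l.
Proof. by case: c => //=; rewrite del_false. Qed.

Lemma del_add (T : Type) (phi psi : seq T -> bool) l :
  del (fun r => phi r (+) psi r) l = del phi l (+) del psi l.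
Proof.
elim: l phi psi => //= x l IH phi psi; rewrite (IH (fun r => phi (x :: r))).
by rewrite addbACA.
Qed.

Lemma del_del (T : Type) (phi : seq T -> bool) l : del (del phi) l = false.
Proof.
elim: l phi => // x l IH phi; rewrite del_cons.
rewrite (del_add phi (del (fun r => phi (x :: r)))) IH.
by rewrite addbF addbb.
Qed.

(** [cup (h :: hs)] is the coboundary of [hcup h hs], and coboundaries are closed; [cup [::]] is the
    constant 0-cochain. *)
Lemma del_cup hs l : del (cup hs) l = false.
Proof.
elim: hs l => [|h hs IH] l.
  case: l => [|v [|v' [|v'' l]]] //=.
  exact: del_false.
suff -> : cup (h :: hs) = del (hcup h hs) by exact: del_del.
apply: functional_extensionality => -[//|v r]; rewrite del_cons.
rewrite (del_and (nth false v h) (fun r => cup hs (v :: r))).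
have := IH (v :: r); rewrite del_cons => /addb_eq ->.
by case: r => [|v' r] /=; [case: hs {IH} => [|h' hs] /=; rewrite andbF|rewrite andb_addl addbC].
Qed.

Lemma del_hcup h hs l : del (hcup h hs) l = cup (h :: hs) l.
Proof.
case: l => // v r; rewrite del_cons.
rewrite (del_and (nth false v h) (fun r => cup hs (v :: r))).
have := del_cup hs (v :: r); rewrite del_cons => /addb_eq ->.
by case: r => [|v' r] /=; [case: hs => [|h' hs] /=; rewrite andbF|rewrite andb_addl addbC].
Qed.

(** The factor belonging to [h] is a difference of two equal bits. *)
Lemma cup_const hs h l : h \in hs ->
  (exists c, forall v, v \in l -> nth false v h = c) -> cup hs l = false.
Proof.
elim: hs l => // h' hs IH [|v [|v' l]] // hhs [c Hc]; rewrite /= .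
move: hhs; rewrite inE; case: eqVneq => [<- _|_ /= hhs].
  by rewrite !Hc ?inE ?eqxx ?orbT // addbb.
rewrite IH ?andbF //; exists c => w wl; apply: Hc; by rewrite inE wl orbT.
Qed.

(** Only differences of bits enter, and negation preserves them. The size condition keeps indices in
    range: the default [false] of [nth] is not negated. *)
Lemma cup_flip m hs l : (forall v, v \in l -> size v = m) -> {in hs, forall h, h < m} ->
  cup hs (map (map negb) l) = cup hs l.
Proof.
elim: hs l => [|h hs IH] [|v [|v' l]] //= sl hm.
have hh : h < m by apply: hm; rewrite inE eqxx.
rewrite !(nth_map false) ?sl ?inE ?eqxx ?orbT // addNb addbN negbK.
congr (_ && _); rewrite -[_ :: _]/(map (map negb) (v' :: l)); apply: IH.
  by move=> w wl; apply: sl; rewrite inE wl orbT.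
by move=> k khs; apply: hm; rewrite inE khs orbT.
Qed.

(* A vertex of the join of the two cubes: [false] for the cube of u, [true] for that of w. *)
Definition V := (bool * seq bool)%type.

(** * Joins of cochains *)

Definition uu (l : seq V) := [seq v.2 | v <- l & ~~ v.1].
Definition ww (l : seq V) := [seq v.2 | v <- l & v.1].
Definition joinc (a b : seq (seq bool) -> bool) (l : seq V) := a (uu l) && b (ww l).

(** Leibniz rule: deleting a vertex deletes it from exactly one factor. The augmentation in [del]
    accounts for a factor losing its last vertex. *)
Lemma del_joinc a b l :
  del (joinc a b) l = joinc (del a) b l (+) joinc a (del b) l.
Proof.
elim: l a b => [|[[] v] l IH] a b; first by rewrite /joinc /= andbF.
- rewrite del_cons (IH a (fun r => b (v :: r))) /joinc /= andb_addr.
  by rewrite addbCA.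
- rewrite del_cons (IH (fun r => a (v :: r)) b) /joinc /= andb_addl.
  by rewrite addbA.
Qed.

(** * Cochains on simplices ordered by label *)

Definition le1 (p q : nat * V) := p.1 <= q.1.

(* [Phi] on the vertices of a simplex ordered by label; degenerate simplices count 0. *)
Definition lift (Phi : seq V -> bool) (s : seq (nat * V)) : bool :=
  uniq (unzip1 s) && Phi (unzip2 (sort le1 s)).

Lemma le1_total : total le1. Proof. by move=> p q; exact: leq_total. Qed.
Lemma le1_trans : transitive le1. Proof. by move=> p q r; exact: leq_trans. Qed.

Lemma unzip1_inj (s : seq (nat * V)) p q :
  uniq (unzip1 s) -> p \in s -> q \in s -> p.1 = q.1 -> p = q.
Proof.
elim: s => //= x s IH /andP[xs us]; rewrite !inE.
have K r : r \in s -> x.1 != r.1 by move=> rs; apply: contraNneq xs => ->; exact: map_f.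
case: eqVneq => [->|_] /=; case: eqVneq => [->|_] //= .
- by move=> _ /K /eqP.
- by move=> /K /eqP H _ E; case: H.
- exact: IH.
Qed.

Lemma lift_perm Phi s s' : perm_eq s s' -> lift Phi s = lift Phi s'.
Proof.
move=> ps; rewrite /lift (perm_uniq (perm_map _ ps)); case us: uniq => //=.
rewrite (_ : sort le1 s = sort le1 s') //; apply/perm_sort_inP => //.
- by move=> p q _ _; exact: le1_total.
- by move=> p q r _ _ _; exact: le1_trans.
- move=> p q ps1 qs1 /andP[pq qp].
  apply: (unzip1_inj us); rewrite -?(perm_mem ps) //.
  by apply/eqP; rewrite eqn_leq; apply/andP.
Qed.

(** With distinct labels both sides may be computed on the sorted list, whose faces are again
    sorted. If a label repeats then, by hypothesis, a whole vertex repeats: the two faces omitting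
    one copy cancel, and all others stay degenerate. *)
Lemma del_lift Phi (s : seq (nat * V)) :
  (forall p q, p \in s -> q \in s -> p.1 = q.1 -> p = q) ->
  del (lift Phi) s = lift (del Phi) s.
Proof.
move=> cs; have pd : forall s s', perm_eq s s' -> del (lift Phi) s = del (lift Phi) s'.
  move=> s1 s2 ps; rewrite !del_rem; try exact: lift_perm.
  rewrite -(perm_big _ ps); apply: eq_big_seq => p ps1; apply: lift_perm.
  rewrite -(perm_cons p) -(permPl (perm_to_rem ps1)) (permPl ps).
  by apply: perm_to_rem; rewrite -(perm_mem ps).
case us: (uniq (unzip1 s)).
- rewrite /lift us /= (pd _ (sort le1 s)); last by rewrite perm_sym perm_sort.
  rewrite -del_map; apply: eq_del => r sr; rewrite /lift.
  have ss : sorted le1 (sort le1 s) by apply: sort_sorted; exact: le1_total.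
  have -> : sort le1 r = r.
    apply: sorted_sort; first exact: le1_trans.
    exact: (subseq_sorted le1_trans sr).
  suff -> : uniq (unzip1 r) by [].
  apply: (subseq_uniq (map_subseq _ sr)).
  by rewrite (perm_uniq (perm_map _ (permEl (perm_sort le1 s)))) us.
- have : ~~ uniq s.
    apply: contraFN us => us; rewrite map_inj_in_uniq // => p q ps qs.
  rewrite /lift us /= => nus.
  have [p [s' ps]] : exists p s', perm_eq s [:: p, p & s'].
    elim: s nus {cs us} => //= x s IH; rewrite negb_and negbK => /orP[xs|/IH[p [s' ps]]].
      by exists x, (rem x s); rewrite perm_cons; exact: perm_to_rem.
    exists p, (x :: s'); rewrite -(perm_cons x) in ps; apply: (perm_trans ps).
    exact: (permEl (perm_catCA [:: x] [:: p; p] s')).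
  rewrite -/(lift Phi) (pd _ _ ps) 2!del_cons addbA addbb addFb.
  rewrite (@eq_del _ _ (fun _ => false)) ?del_false // => r _.
  by rewrite /lift /= inE eqxx.
Qed.

Definition flipv (v : V) : V := (v.1, map negb v.2).
Definition flipp (p : nat * V) : nat * V := (p.1, flipv p.2).

Lemma lift_flip Phi s : lift Phi (map flipp s) = lift (fun vs => Phi (map flipv vs)) s.
Proof.
rewrite /lift /unzip1 /unzip2 -!map_comp; congr (_ && Phi _).
by rewrite sort_map -!map_comp.
Qed.

Lemma uu_flip vs : uu (map flipv vs) = map (map negb) (uu vs).
Proof. by rewrite /uu filter_map -!map_comp. Qed.

Lemma ww_flip vs : ww (map flipv vs) = map (map negb) (ww vs).
Proof. by rewrite /ww filter_map -!map_comp. Qed.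

Lemma mem_uu vs s : (s \in uu vs) = ((false, s) \in vs).
Proof.
apply/mapP/idP => [[[b s'] + /= ->]|vs_s]; first by rewrite mem_filter => /andP[/negbTE /= ->].
by exists (false, s); rewrite ?mem_filter.
Qed.

Lemma mem_ww vs s : (s \in ww vs) = ((true, s) \in vs).
Proof.
apply/mapP/idP => [[[b s'] + /= ->]|vs_s]; first by rewrite mem_filter => /andP[/= ->].
by exists (true, s); rewrite ?mem_filter.
Qed.

Lemma uu_nil vs : (forall v, v \in vs -> v.1 = true) -> uu vs = [::].
Proof.
move=> H; case E: (uu vs) => [//|s l].
have : s \in uu vs by rewrite E inE eqxx.
by rewrite mem_uu => /H.
Qed.

Lemma ww_nil vs : (forall v, v \in vs -> v.1 = false) -> ww vs = [::].
Proof.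
move=> H; case E: (ww vs) => [//|s l].
have : s \in ww vs by rewrite E inE eqxx.
by rewrite mem_ww => /H.
Qed.

(** * Labelled grids *)

(** The gluing of the last slice to the first: it reflects the coordinates of u and w, fixes t and
    resets the position on the circle. *)
Definition mirror m N (x : nat -> nat) : nat -> nat :=
  fun i => if i < m.*2 then N - x i else if i == m.*2.+1 then 0 else x i.

(* Coordinates [0 .. m-1] are those of u, [m .. 2m-1] those of w, [2m] is t, [2m+1] is the
   position along the circle. *)
Record labelling (m N : nat) (lab : (nat -> nat) -> nat * V) : Prop := Labelling {
  lab_cell : forall x y, (forall i, x i <= N) -> (forall i, y i <= N) ->
    (forall i, x i <= (y i).+1) -> (forall i, y i <= (x i).+1) ->
    (lab x).1 = (lab y).1 -> lab x = lab y;
  lab_size : forall x, (forall i, x i <= N) -> size (lab x).2.2 = m;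
  lab_u : forall x j, (forall i, x i <= N) -> j < m -> (lab x).2.1 = false ->
    (x j = 0 -> nth false (lab x).2.2 j = false) /\
    (x j = N -> nth false (lab x).2.2 j = true);
  lab_w : forall x j, (forall i, x i <= N) -> j < m -> (lab x).2.1 = true ->
    (x (m + j) = 0 -> nth false (lab x).2.2 j = false) /\
    (x (m + j) = N -> nth false (lab x).2.2 j = true);
  lab_t : forall x, (forall i, x i <= N) ->
    (x m.*2 = 0 -> (lab x).2.1 = false) /\ (x m.*2 = N -> (lab x).2.1 = true);
  lab_s : forall x, (forall i, x i <= N) -> x m.*2.+1 = N ->
    lab x = flipp (lab (mirror m N x)) }.

Definition cochain (lab : (nat -> nat) -> nat * V) Phi (l : seq (nat -> nat)) :=
  lift Phi (map lab l).

Lemma mem_map_allp (T : Type) (T' : eqType) (f : T -> T') (P : T -> Prop) l y :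
  allp P l -> y \in map f l -> exists x, P x /\ y = f x.
Proof.
elim: l => //= x l IH [Px Pl]; rewrite inE => /orP[/eqP ->|/(IH Pl) //].
by exists x.
Qed.

Lemma good_pts N S z l : good N S z l ->
  allp (fun x => (forall i, x i <= N) /\ (forall i, i \notin S -> x i = z i)) l.
Proof.
move=> [_ [b [e [H]]]]; elim: l => //= x l IH [Hx /IH Hl]; split=> //.
split=> i; first by case: (Hx i) => ->; case: (H i).
by move=> iS; case: (H i) => _ _ _ _ /(_ iS)[bz ez]; case: (Hx i) => ->.
Qed.

(** Corners of one cube are neighbours, so [lab_cell] supplies the hypothesis of [del_lift]. *)
Lemma del_cochain m N lab S z l Phi : labelling m N lab -> good N S z l ->
  del (cochain lab Phi) l = cochain lab (del Phi) l.
Proof.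
move=> L G; rewrite /cochain del_map; apply: del_lift => p q.
have [_ [b [e [H Hl]]]] := G.
move=> /(mem_map_allp Hl)[x [Hx ->]] /(mem_map_allp Hl)[y [Hy ->]].
have box x' : (forall i, x' i = b i \/ x' i = e i) -> forall i, x' i <= N.
  by move=> K i; case: (K i) => ->; case: (H i).
apply: (lab_cell L); [exact: box|exact: box| |] => i;
  by case: (H i) => _ _ h1 h2 _; case: (Hx i) => ->; case: (Hy i) => ->.
Qed.

Lemma eq_cochain N lab S z l (Phi Psi : seq V -> bool) : good N S z l ->
  (forall vs, (forall v, v \in vs -> exists x, [/\ forall i, x i <= N,
      forall i, i \notin S -> x i = z i & v = (lab x).2]) -> Phi vs = Psi vs) ->
  cochain lab Phi l = cochain lab Psi l.
Proof.
move=> G H; rewrite /cochain /lift; congr (_ && _); apply: H => v.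
case/mapP => p; rewrite mem_sort => /(mem_map_allp (good_pts G))[x [[Hx Hx'] ->]] ->.
by exists x.
Qed.

Lemma J_cochain m N lab S z Phi k : labelling m N lab -> (forall i, z i <= N) ->
  uniq S -> size S = k.+1 ->
  J N S z (cochain lab (del Phi)) =
  \xor_(j <- S) (J N (dels j S) (upd z j 0) (cochain lab Phi) (+)
                 J N (dels j S) (upd z j N) (cochain lab Phi)).
Proof.
move=> L zN uS sS; rewrite -(J_del _ _ _ uS sS); apply: eq_J => // l G.
by rewrite (del_cochain _ L G).
Qed.

Lemma upd_box N z j a : (forall i, z i <= N) -> a <= N -> forall i, upd z j a i <= N.
Proof. by move=> zN aN i; rewrite /upd; case: eqP. Qed.

Lemma J_eq N lab S z Phi Psi : (forall i, z i <= N) ->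
  (forall vs, (forall v, v \in vs -> exists x, [/\ forall i, x i <= N,
      forall i, i \notin S -> x i = z i & v = (lab x).2]) -> Phi vs = Psi vs) ->
  J N S z (cochain lab Phi) = J N S z (cochain lab Psi).
Proof. by move=> zN H; apply: eq_J => // l G; apply: eq_cochain G H. Qed.

Lemma J_eq_false N lab S z Phi : (forall i, z i <= N) ->
  (forall vs, (forall v, v \in vs -> exists x, [/\ forall i, x i <= N,
      forall i, i \notin S -> x i = z i & v = (lab x).2]) -> Phi vs = false) ->
  J N S z (cochain lab Phi) = false.
Proof.
move=> zN H; rewrite (@J_eq _ _ _ _ _ (fun _ => false)) //; apply: J_eq0 => // l _.
by rewrite /cochain /lift andbF.
Qed.

(** On a facet of a coordinate of u (or w) the corresponding bit is constant, so the factor [a] (or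
    [b]) vanishes. On a facet of t all vertices belong to one cube, and the other factor is
    evaluated on the empty simplex. *)
Lemma J_face m N lab S z a b j c : labelling m N lab -> (forall i, z i <= N) ->
  c = 0 \/ c = N -> a [::] = false -> b [::] = false -> j <= m.*2 ->
  (j < m -> forall l, (exists d, forall v, v \in l -> nth false v j = d) -> a l = false) ->
  (m <= j < m.*2 -> forall l, (exists d, forall v, v \in l -> nth false v (j - m) = d) -> b l = false) ->
  J N (dels j S) (upd z j c) (cochain lab (joinc a b)) = false.
Proof.
move=> L zN cN a0 b0 jm Ha Hb; apply: J_eq_false => [|vs Hvs].
  by apply: upd_box => //; case: cN => ->.
have {}Hvs v : v \in vs -> exists x, [/\ forall i, x i <= N, x j = c & v = (lab x).2].
  move=> /Hvs[x [Hx Hx' ->]]; exists x; split=> //.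
  by rewrite Hx' ?mem_dels ?eqxx // /upd eqxx.
rewrite /joinc; case: (ltnP j m) => [jlt|mj].
  rewrite Ha //; exists (if c == 0 then false else true) => v.
  rewrite mem_uu => /Hvs[x [Hx xc E]].
  have [] := lab_u L Hx jlt; rewrite -?E //= xc => H0 HN.
  case: eqP => [/H0 //|cn0]; apply: HN; by case: cN.
move: jm; rewrite leq_eqVlt => /orP[/eqP jt|jlt].
  subst j; case: cN => cE.
    rewrite ww_nil ?b0 ?andbF // => v /Hvs[x [Hx xc ->]].
    by have [H _] := lab_t L Hx; apply: H; rewrite xc.
  rewrite uu_nil ?a0 // => v /Hvs[x [Hx xc ->]].
  by have [_ H] := lab_t L Hx; apply: H; rewrite xc.
have jm' : j - m < m by lia.
rewrite Hb ?andbF // ?mj //; exists (if c == 0 then false else true) => v.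
rewrite mem_ww => /Hvs[x [Hx xc E]].
have [] := lab_w L Hx jm'; rewrite -?E //= subnKC // xc => H0 HN.
case: eqP => [/H0 //|cn0]; apply: HN; by case: cN.
Qed.

(** * The count on a slice *)

Lemma cup_nil hs : cup hs [::] = false.
Proof. by case: hs. Qed.

Lemma dels_cons k S : k \notin S -> dels k (k :: S) = S.
Proof.
move=> kS; rewrite /dels /= eqxx; apply/all_filterP/allP => j jS.
by apply: contraNneq kS => <-.
Qed.

(** One step of Sperner's descent. The cochain is the coboundary of the join with [hcup k hs], so
    the count moves to the boundary. At [x k = 0] bit [k] of every u-vertex is false and kills
    [hcup]; at [x k = N] it is true and leaves [cup hs]; [J_face] removes the other facets. *)
Lemma J_stage_u m N lab k z : labelling m N lab -> (forall i, z i <= N) -> k < m ->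
  J N (iota k (m.*2.+1 - k)) z
    (cochain lab (joinc (cup (iota k (m - k))) (cup (iota 0 m)))) =
  J N (iota k.+1 (m.*2.+1 - k.+1)) (upd z k N)
    (cochain lab (joinc (cup (iota k.+1 (m - k.+1))) (cup (iota 0 m)))).
Proof.
move=> L zN km.
set hs := iota k.+1 (m - k.+1); set S := iota k.+1 _.
have k2 : k < m.*2.+1 by lia.
have -> : iota k (m.*2.+1 - k) = k :: S by rewrite -(subnSK k2); exact: erefl.
have -> : iota k (m - k) = k :: hs by rewrite -(subnSK km); exact: erefl.
have E : joinc (cup (k :: hs)) (cup (iota 0 m)) = del (joinc (hcup k hs) (cup (iota 0 m))).
  apply: functional_extensionality => l; rewrite del_joinc /joinc del_hcup del_cup.
  by rewrite andbF addbF.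
have kS : k \notin S by rewrite mem_iota; lia.
rewrite E (@J_cochain m _ _ _ _ _ (size S) L zN) //; last by rewrite cons_uniq kS iota_uniq.
have H0 : cup (iota 0 m) [::] = false by exact: cup_nil.
have Hb j : m <= j < m.*2 -> forall l,
    (exists d, forall v, v \in l -> nth false v (j - m) = d) -> cup (iota 0 m) l = false.
  by move=> mj l; apply: cup_const; rewrite mem_iota; lia.
rewrite big_cons [X in _ (+) X]big1_seq ?addbF; last first.
  move=> j /andP[_]; rewrite mem_iota => jS.
  have Ha : j < m -> forall l,
      (exists d, forall v, v \in l -> nth false v j = d) -> hcup k hs l = false.
    move=> jm [//|v l] Hl; rewrite /= (@cup_const _ j) ?andbF // mem_iota; lia.
  by rewrite !(@J_face m) //; (try by left); (try by right); try (exact: Hb); lia.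
rewrite dels_cons //.
rewrite (_ : J N S (upd z k 0) _ = false) ?addFb; last first.
  apply: J_eq_false => [|vs Hvs]; first exact: upd_box.
  rewrite /joinc /hcup; case E1: (uu vs) => [|s l] //.
  have /Hvs [x [Hx Hx' Es]] : (false, s) \in vs by rewrite -mem_uu E1 inE eqxx.
  have [] := lab_u L Hx km; rewrite -?Es //= Hx' // /upd eqxx => -> //.
apply: J_eq => [|vs Hvs]; first exact: upd_box.
rewrite /joinc /hcup; case E1: (uu vs) => [|s l]; first by rewrite cup_nil.
have /Hvs [x [Hx Hx' Es]] : (false, s) \in vs by rewrite -mem_uu E1 inE eqxx.
have [] := lab_u L Hx km; rewrite -?Es //= Hx' // /upd eqxx => _ -> //.
Qed.

(** The same descent for w. By now the factor of u is [cup [::]], which asks for exactly one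
    u-vertex. *)
Lemma J_stage_w m N lab k z : labelling m N lab -> (forall i, z i <= N) -> k < m ->
  J N (iota (m + k) (m - k).+1) z
    (cochain lab (joinc (cup [::]) (cup (iota k (m - k))))) =
  J N (iota (m + k.+1) (m - k.+1).+1) (upd z (m + k) N)
    (cochain lab (joinc (cup [::]) (cup (iota k.+1 (m - k.+1))))).
Proof.
move=> L zN km.
set hs := iota k.+1 (m - k.+1); set S := iota (m + k.+1) _.
have -> : iota (m + k) (m - k).+1 = (m + k) :: S by rewrite -(subnSK km) /S addnS; exact: erefl.
have -> : iota k (m - k) = k :: hs by rewrite -(subnSK km); exact: erefl.
have E : joinc (cup [::]) (cup (k :: hs)) = del (joinc (cup [::]) (hcup k hs)).
  apply: functional_extensionality => l; rewrite del_joinc /joinc del_hcup del_cup.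
  by [].
have kS : m + k \notin S by rewrite mem_iota; lia.
rewrite E (@J_cochain m _ _ _ _ _ (size S) L zN) //; last by rewrite cons_uniq kS iota_uniq.
rewrite big_cons [X in _ (+) X]big1_seq ?addbF; last first.
  move=> j /andP[_]; rewrite mem_iota => jS.
  have Hb : m <= j < m.*2 -> forall l,
      (exists d, forall v, v \in l -> nth false v (j - m) = d) -> hcup k hs l = false.
    move=> jm [//|v l] Hl; rewrite /= (@cup_const _ (j - m)) ?andbF // mem_iota; lia.
  by rewrite !(@J_face m) //; (try by left); (try by right); try (exact: Hb); lia.
rewrite dels_cons //.
rewrite (_ : J N S (upd z (m + k) 0) _ = false) ?addFb; last first.
  apply: J_eq_false => [|vs Hvs]; first exact: upd_box.
  rewrite /joinc /hcup; case E1: (ww vs) => [|s l]; first by rewrite andbF.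
  have /Hvs [x [Hx Hx' Es]] : (true, s) \in vs by rewrite -mem_ww E1 inE eqxx.
  have [] := lab_w L Hx km; rewrite -?Es //= Hx' // /upd eqxx => -> // _.
  by rewrite andbF.
apply: J_eq => [|vs Hvs]; first exact: upd_box.
rewrite /joinc /hcup; case E1: (ww vs) => [|s l]; first by rewrite cup_nil.
have /Hvs [x [Hx Hx' Es]] : (true, s) \in vs by rewrite -mem_ww E1 inE eqxx.
have [] := lab_w L Hx km; rewrite -?Es //= Hx' // /upd eqxx => _ -> //.
Qed.

(** What remains is a line in direction t, whose edges count when they join a u-vertex to a
    w-vertex; its ends are of different kinds, so the number of such edges is odd. *)
Lemma J_stage_t m N lab z : labelling m N lab -> (forall i, z i <= N) ->
  J N [:: m.*2] z (cochain lab (joinc (cup [::]) (cup [::]))) = true.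
Proof.
move=> L zN.
(* [nilp] is 1 on the empty simplex only, and its coboundary is [cup [::]]. *)
have E : joinc (cup [::]) (cup [::]) = del (joinc (cup [::]) (@nilp _)).
  apply: functional_extensionality => l; rewrite del_joinc /joinc del_cup /=.
  congr (_ && _); case: (ww l) => [|v [|w r]] //=.
  by rewrite (@del_false _ r).
rewrite E (@J_cochain m _ _ _ _ _ 0 L zN) // big_seq1 dels_cons //.
have J0 c : J N [::] (upd z m.*2 c) (cochain lab (joinc (cup [::]) (@nilp _))) =
  ~~ (lab (upd z m.*2 c)).2.1.
  rewrite /J /= /cochain /lift /= /joinc /uu /ww /=.
  by case: (lab _) => a [[] s] /=.
rewrite !J0.
have [H0 _] := lab_t L (@upd_box N z m.*2 0 zN (leq0n N)).
have [_ HN] := lab_t L (@upd_box N z m.*2 N zN (leqnn N)).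
by rewrite H0 ?HN // /upd eqxx.
Qed.

Lemma J_slice m N lab z : labelling m N lab -> (forall i, z i <= N) ->
  J N (iota 0 m.*2.+1) z (cochain lab (joinc (cup (iota 0 m)) (cup (iota 0 m)))) = true.
Proof.
move=> L zN.
have HU k : k <= m -> exists z', (forall i, z' i <= N) /\
  J N (iota 0 m.*2.+1) z (cochain lab (joinc (cup (iota 0 m)) (cup (iota 0 m)))) =
  J N (iota k (m.*2.+1 - k)) z'
    (cochain lab (joinc (cup (iota k (m - k))) (cup (iota 0 m)))).
  elim: k => [_|k IH km]; first by exists z; rewrite !subn0.
  have [|z' [zN' ->]] := IH; first exact: ltnW.
  exists (upd z' k N); split; first exact: upd_box.
  exact: J_stage_u.
have [z1 [zN1 ->]] := HU m (leqnn m); rewrite subnn.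
have HW k : k <= m -> exists z', (forall i, z' i <= N) /\
  J N (iota m (m.*2.+1 - m)) z1 (cochain lab (joinc (cup [::]) (cup (iota 0 m)))) =
  J N (iota (m + k) (m - k).+1) z'
    (cochain lab (joinc (cup [::]) (cup (iota k (m - k))))).
  elim: k => [_|k IH km].
    by exists z1; rewrite subn0 addn0 -addnn -addnS addKn.
  have [|z' [zN' ->]] := IH; first exact: ltnW.
  exists (upd z' (m + k) N); split; first exact: upd_box.
  exact: J_stage_w.
have [z2 [zN2 ->]] := HW m (leqnn m); rewrite subnn addnn.
exact: J_stage_t L zN2.
Qed.

(* One of the two halves of [cup (iota 0 m)] exchanged by the antipodal map. *)
Definition cup0 m (l : seq (seq bool)) := cup (iota 0 m) l && nth false (head [::] l) 0.

(** Stokes' formula for [om0] over the whole grid makes its counts on the first and last slices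
    agree, while the gluing turns the latter into the count of the antipode of [om0] on the first
    slice. The two add up to the count of [om], which is 1 by [J_slice]. *)
Theorem labels_lower_bound m N lab : 0 < m -> ~~ odd N -> labelling m N lab ->
  ~ (forall x, (forall i, x i <= N) -> (lab x).1 < m.*2.+2).
Proof.
move=> m0 oN L HK.
pose om := joinc (cup (iota 0 m)) (cup (iota 0 m)).
pose om0 := joinc (cup0 m) (cup (iota 0 m)).
pose z0 : nat -> nat := fun _ => 0.
have z0N i : z0 i <= N by [].
set S := iota 0 m.*2.+1; set t := m.*2.+1.
(* Exactly one of a cube vertex and its antipode has the first bit set; [m] is positive, so this bit
   exists. *)
have split_om : J N S z0 (cochain lab om) =
    J N S z0 (cochain lab om0) (+)
    J N S z0 (cochain lab (fun vs => om0 (map flipv vs))).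
  rewrite -J_add; apply: eq_J => // l G.
  transitivity (cochain lab (fun vs => om0 vs (+) om0 (map flipv vs)) l); last first.
    by rewrite /cochain /lift -andb_addr.
  apply: (eq_cochain G) => vs Hvs.
  have szu b s : (b, s) \in vs -> size s = m.
    by move=> /Hvs[x [Hx _ E]]; have := lab_size L Hx; rewrite -E.
  rewrite /om /om0 /joinc uu_flip ww_flip.
  rewrite (@cup_flip m _ (ww vs)); first last.
  - by move=> h; rewrite mem_iota.
  - by move=> v; rewrite mem_ww => /szu.
  rewrite -andb_addl; congr (_ && _).
  rewrite /cup0 (@cup_flip m); first last.
  - by move=> h; rewrite mem_iota.
  - by move=> v; rewrite mem_uu => /szu.
  case E : (uu vs) => [|s l']; first by rewrite cup_nil.
  rewrite /= (nth_map false) ?(szu false) -?mem_uu ?E ?inE ?eqxx //.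
  by rewrite -andb_addr addbN addbb andbT.
(* A top simplex has [m.*2 + 3] vertices but only [m.*2 + 2] labels are available, so a label
   repeats and [lift] gives 0. *)
have full : J N (iota 0 m.*2.+2) z0 (cochain lab (del om0)) = false.
  apply: J_eq0 => // l G; rewrite /cochain /lift.
  suff -> : uniq (unzip1 (map lab l)) = false by [].
  apply/negP => ul.
  have sub : {subset unzip1 (map lab l) <= iota 0 m.*2.+2}.
    move=> i /mapP[p /(mem_map_allp (good_pts G))[x [[Hx _] ->]] ->].
    by rewrite mem_iota; exact: HK.
  have := uniq_leq_size ul sub; rewrite size_iota /unzip1 !size_map.
  by have [-> _] := G; rewrite size_iota ltnn.
have Ss : iota 0 m.*2.+2 = S ++ [:: t] by rewrite -[m.*2.+2]addn1 iotaD.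
have dS : dels t (S ++ [:: t]) = S.
  rewrite /dels filter_cat [X in _ ++ X](_ : _ = [::]) ?cats0; last by rewrite /= eqxx.
  apply/all_filterP/allP => j.
  by rewrite mem_iota /t; lia.
have ends : J N S (upd z0 t 0) (cochain lab om0) = J N S (upd z0 t N) (cochain lab om0).
  move: full; rewrite (@J_cochain m _ _ _ _ _ m.*2.+1 L) ?iota_uniq ?size_iota //.
  rewrite Ss big_cat big_seq1 dS big1_seq; first by rewrite /= => /addb_eq/esym.
  
  move=> j /andP[_]; rewrite mem_iota => jS.
  have Ha : j < m -> forall l,
      (exists d, forall v, v \in l -> nth false v j = d) -> cup0 m l = false.
    by move=> jm l Hl; rewrite /cup0 (@cup_const _ j) // mem_iota; lia.
  have Hb : m <= j < m.*2 -> forall l,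
      (exists d, forall v, v \in l -> nth false v (j - m) = d) -> cup (iota 0 m) l = false.
    by move=> mj l; apply: cup_const; rewrite mem_iota; lia.
  by rewrite !(@J_face m) //; (try by left); (try by right); rewrite /cup0 ?cup_nil //; lia.
(* Reflection carries the last slice to the first, and [lab_s] turns it into the antipodal map on
   cube vertices. *)
have twist : J N S (upd z0 t N) (cochain lab om0) =
    J N S z0 (cochain lab (fun vs => om0 (map flipv vs))).
  transitivity (J N S (upd z0 t N)
      (fun l => cochain lab (fun vs => om0 (map flipv vs)) (map (mirror m N) l))).
    apply: eq_J => [|l G]; first exact: upd_box.
    rewrite /cochain -lift_flip -!map_comp; congr lift.
    have : allp (fun x => (forall i, x i <= N) /\ x t = N) l.
      have := good_pts G; elim: (l) => //= x l' IH [[Hx Hx'] /IH Hl]; split=> //.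
      by split=> //; rewrite Hx' /upd ?eqxx // mem_iota /t; lia.
    elim: (l) => //= x l' IH [[Hx Hx'] /IH ->].
    by rewrite (lab_s L Hx Hx').
  rewrite (@J_reflect _ _ _ _ (mirror m N) (fun j => j < m.*2)) //; last first.
    move=> b j v; rewrite mem_iota => jS.
    apply: functional_extensionality => i; rewrite /mirror /upd.
    case: (eqVneq i j) => [->|//]; case: ifP => // jm.
    by case: eqP => // E; lia.
  apply: eq_J_start => i; rewrite mem_iota => iS; rewrite /mirror /upd /z0 /t.
  by case: ifP => [|_]; [lia|case: eqP].
have := J_slice L z0N; rewrite -/S -/om split_om -twist -ends.
by rewrite (@eq_J_start _ _ _ z0) ?addbb // => i _; rewrite /upd; case: eqP.
Qed.
End Comb.

(** * Euclidean distance *)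

Open Scope R_scope.

Lemma sumR_ext k f g : (forall i, (i < k)%nat -> f i = g i) -> sumR k f = sumR k g.
Proof. induction k; simpl; intros H; auto. rewrite IHk, H; auto. Qed.

Lemma sumR_le k f g : (forall i, (i < k)%nat -> f i <= g i) -> sumR k f <= sumR k g.
Proof.
  induction k; simpl; intros H; [lra|].
  apply Rplus_le_compat; auto.
Qed.

Lemma sumR_lt k f g j : (forall i, (i < k)%nat -> f i <= g i) ->
  (j < k)%nat -> f j < g j -> sumR k f < sumR k g.
Proof.
  induction k; simpl; intros H Hj L; [lia|].
  destruct (Nat.eq_dec j k) as [->|Hn].
  - assert (sumR k f <= sumR k g) by (apply sumR_le; auto). lra.
  - assert (sumR k f < sumR k g) by (apply IHk; auto; lia).
    assert (f k <= g k) by auto. lra.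
Qed.

Lemma sumR_nonneg k f : (forall i, (i < k)%nat -> 0 <= f i) -> 0 <= sumR k f.
Proof.
  induction k; simpl; intros H; [lra|].
  apply Rplus_le_le_0_compat; auto.
Qed.

Lemma sumR_eq0 k f : (forall i, (i < k)%nat -> 0 <= f i) -> sumR k f = 0 ->
  forall i, (i < k)%nat -> f i = 0.
Proof.
  induction k; simpl; intros H E i Hi; [lia|].
  assert (0 <= sumR k f) by (apply sumR_nonneg; auto).
  assert (0 <= f k) by auto.
  destruct (Nat.eq_dec i k) as [->|Hn]; [lra|].
  apply IHk; auto; [lra|lia].
Qed.

Lemma sumR_scal k c f : sumR k (fun i => c * f i) = c * sumR k f.
Proof. induction k; simpl; [lra|]. rewrite IHk; lra. Qed.

Lemma sumR_const k c : sumR k (fun _ => c) = INR k * c.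
Proof. induction k; cbn [sumR]; [simpl; lra|]. rewrite IHk, S_INR; lra. Qed.

Definition nrm (n : nat) (f : vec) : R := sqrt (sumR n (fun i => f i ^ 2)).

Lemma sumsq_nonneg n (f : vec) : 0 <= sumR n (fun i => f i ^ 2).
Proof. apply sumR_nonneg; intros; apply pow2_ge_0. Qed.

Lemma nrm_nonneg n f : 0 <= nrm n f.
Proof. apply sqrt_pos. Qed.

Lemma nrm_sq n f : nrm n f ^ 2 = sumR n (fun i => f i ^ 2).
Proof. unfold nrm. rewrite pow2_sqrt; auto. apply sumsq_nonneg. Qed.

Lemma nrm_eq0 n f : nrm n f = 0 -> forall i, (i < n)%nat -> f i = 0.
Proof.
  intros H i Hi.
  assert (E : sumR n (fun i => f i ^ 2) = 0) by (rewrite <- nrm_sq, H; ring).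
  assert (f i ^ 2 = 0).
  { apply (sumR_eq0 n (fun i => f i ^ 2)); auto. intros; apply pow2_ge_0. }
  nra.
Qed.

Lemma sumR_lin_sq n a b (f g : vec) :
  sumR n (fun i => (b * f i - a * g i) ^ 2) =
  b ^ 2 * sumR n (fun i => f i ^ 2) - 2 * (a * b) * sumR n (fun i => f i * g i)
  + a ^ 2 * sumR n (fun i => g i ^ 2).
Proof. induction n; cbn [sumR]; [lra|]. rewrite IHn. ring. Qed.

(** Expand the sum of squares of [b f - a g], where [a] and [b] are the norms of [f] and [g];
    cancelling [a b] requires treating zero norms apart. *)
Lemma cauchy_schwarz n f g : sumR n (fun i => f i * g i) <= nrm n f * nrm n g.
Proof.
  set (a := nrm n f). set (b := nrm n g).
  assert (Ha : 0 <= a) by apply nrm_nonneg.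
  assert (Hb : 0 <= b) by apply nrm_nonneg.
  assert (E := sumR_lin_sq n a b f g).
  rewrite <- (nrm_sq n f), <- (nrm_sq n g) in E. fold a b in E.
  assert (P : 0 <= sumR n (fun i => (b * f i - a * g i) ^ 2)) by apply sumsq_nonneg.
  set (c := sumR n (fun i => f i * g i)) in *.
  destruct (Req_dec a 0) as [Z|Z].
  - assert (c = 0); [|nra].
    unfold c. rewrite (sumR_ext n _ (fun _ => 0)).
    + rewrite sumR_const; ring.
    + intros i Hi. rewrite (nrm_eq0 n f Z i Hi); ring.
  - destruct (Req_dec b 0) as [Z'|Z'].
    + assert (c = 0); [|nra].
      unfold c. rewrite (sumR_ext n _ (fun _ => 0)).
      * rewrite sumR_const; ring.
      * intros i Hi. rewrite (nrm_eq0 n g Z' i Hi); ring.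
    + assert (0 < a * b) by (apply Rmult_lt_0_compat; lra). nra.
Qed.

Lemma sumR_add_sq n (f g : vec) :
  sumR n (fun i => (f i + g i) ^ 2) =
  sumR n (fun i => f i ^ 2) + 2 * sumR n (fun i => f i * g i) + sumR n (fun i => g i ^ 2).
Proof. induction n; cbn [sumR]; [lra|]. rewrite IHn. ring. Qed.

Lemma nrm_triangle n f g : nrm n (fun i => f i + g i) <= nrm n f + nrm n g.
Proof.
  assert (Ha := nrm_nonneg n f). assert (Hb := nrm_nonneg n g).
  apply Rsqr_incr_0_var; [|lra].
  rewrite !Rsqr_pow2, nrm_sq, sumR_add_sq, <- !nrm_sq.
  assert (C := cauchy_schwarz n f g). nra.
Qed.

(** Equality here forces equality in the Cauchy-Schwarz inequality, so the sum of squares used there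
    vanishes. *)
Lemma nrm_triangle_eq n f g : nrm n (fun i => f i + g i) = nrm n f + nrm n g ->
  forall i, (i < n)%nat -> nrm n g * f i = nrm n f * g i.
Proof.
  intros E i Hi.
  assert (S : sumR n (fun i => f i * g i) = nrm n f * nrm n g).
  { assert (F := nrm_sq n (fun i => f i + g i)).
    rewrite E, sumR_add_sq, <- !nrm_sq in F. nra. }
  assert (Q := sumR_lin_sq n (nrm n f) (nrm n g) f g).
  rewrite S, <- (nrm_sq n f), <- (nrm_sq n g) in Q.
  assert (Z : sumR n (fun i => (nrm n g * f i - nrm n f * g i) ^ 2) = 0) by (rewrite Q; ring).
  assert ((nrm n g * f i - nrm n f * g i) ^ 2 = 0).
  { apply (sumR_eq0 n (fun i => (nrm n g * f i - nrm n f * g i) ^ 2)); auto.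
    intros; apply pow2_ge_0. }
  nra.
Qed.

Lemma nrm_ext n f g : (forall i, (i < n)%nat -> f i = g i) -> nrm n f = nrm n g.
Proof. intros H. unfold nrm. f_equal. apply sumR_ext. intros i Hi. rewrite H; auto. Qed.

Lemma euclid_nrm n x y : euclid n x y = nrm n (fun i => x i - y i).
Proof. reflexivity. Qed.

Lemma euclid_nonneg n x y : 0 <= euclid n x y.
Proof. apply sqrt_pos. Qed.

Lemma euclid_refl n x : euclid n x x = 0.
Proof.
  unfold euclid. rewrite (sumR_ext n _ (fun _ => 0)) by (intros; ring).
  rewrite sumR_const, Rmult_0_r. apply sqrt_0.
Qed.

Lemma euclid_sym n x y : euclid n x y = euclid n y x.
Proof. unfold euclid. f_equal. apply sumR_ext. intros; ring. Qed.

Lemma euclid_triangle n x y z : euclid n x z <= euclid n x y + euclid n y z.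
Proof.
  rewrite !euclid_nrm.
  rewrite (nrm_ext n (fun i => x i - z i) (fun i => (x i - y i) + (y i - z i)));
    [apply (nrm_triangle n (fun i => x i - y i) (fun i => y i - z i))|intros; ring].
Qed.

Lemma euclid_eq0 n x y : inRn n x -> inRn n y -> euclid n x y = 0 -> x = y.
Proof.
  intros Hx Hy E. apply functional_extensionality; intros i.
  destruct (le_lt_dec n i) as [L|L].
  - rewrite Hx, Hy; auto.
  - assert (x i - y i = 0) by (apply (nrm_eq0 n (fun i => x i - y i) E i L)). lra.
Qed.

Definition seg (x y : vec) (r : R) : vec := fun j => x j + r * (y j - x j).

Lemma seg_inRn n x y r : inRn n x -> inRn n y -> inRn n (seg x y r).
Proof. intros Hx Hy i Hi. unfold seg. rewrite Hx, Hy; auto; ring. Qed.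

Lemma nrm_scal n c f : 0 <= c -> nrm n (fun i => c * f i) = c * nrm n f.
Proof.
  intros Hc. unfold nrm.
  rewrite (sumR_ext n _ (fun i => c ^ 2 * f i ^ 2)) by (intros; ring).
  rewrite sumR_scal, sqrt_mult_alt, sqrt_pow2; auto. nra.
Qed.

Lemma euclid_seg n x y r r' : euclid n (seg x y r) (seg x y r') = Rabs (r - r') * euclid n x y.
Proof.
  rewrite !euclid_nrm.
  rewrite <- nrm_scal by apply Rabs_pos.
  unfold Rabs. destruct (Rcase_abs (r - r')).
  - apply nrm_ext; intros; unfold seg; ring.
  - unfold nrm. f_equal. apply sumR_ext; intros; unfold seg; ring.
Qed.

Lemma euclid_seg2 n x y x' y' r : 0 <= r <= 1 ->
  euclid n (seg x y r) (seg x' y' r) <= euclid n x x' + euclid n y y'.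
Proof.
  intros Hr. rewrite !euclid_nrm.
  rewrite (nrm_ext n _ (fun i => (1 - r) * (x i - x' i) + r * (y i - y' i)))
    by (intros; unfold seg; ring).
  eapply Rle_trans;
    [apply (nrm_triangle n (fun i => (1 - r) * (x i - x' i)) (fun i => r * (y i - y' i)))|].
  rewrite !nrm_scal by lra.
  assert (A := nrm_nonneg n (fun i => x i - x' i)).
  assert (B := nrm_nonneg n (fun i => y i - y' i)). nra.
Qed.

Lemma euclid_between n x a y : inRn n x -> inRn n a -> inRn n y -> 0 < euclid n x y ->
  euclid n x a + euclid n a y = euclid n x y -> a = seg x y (euclid n x a / euclid n x y).
Proof.
  intros Hx Ha Hy D E. apply functional_extensionality; intros i.
  destruct (le_lt_dec n i) as [L|L].
  - unfold seg. rewrite Hx, Ha, Hy; auto; ring.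
  - assert (T : nrm n (fun i => (x i - a i) + (a i - y i)) =
        nrm n (fun i => x i - a i) + nrm n (fun i => a i - y i)).
    { rewrite <- !euclid_nrm, E, euclid_nrm. apply nrm_ext; intros; ring. }
    assert (Q := nrm_triangle_eq n _ _ T i L). cbv beta in Q.
    rewrite <- !euclid_nrm in Q. unfold seg.
    replace (euclid n a y) with (euclid n x y - euclid n x a) in Q by lra.
    field_simplify; [|lra]. apply Rmult_eq_reg_r with (euclid n x y); [|lra].
    field_simplify; [|lra]. nra.
Qed.

Lemma euclid_le_max n x y e : 0 <= e -> (forall i, (i < n)%nat -> Rabs (x i - y i) <= e) ->
  euclid n x y <= INR n * e.
Proof.
  intros He H. unfold euclid.
  assert (P := pos_INR n).
  rewrite <- (sqrt_pow2 (INR n * e)) by nra.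
  apply sqrt_le_1_alt. apply Rle_trans with (sumR n (fun _ => e ^ 2)).
  - apply sumR_le. intros i Hi. apply pow_maj_Rabs. auto.
  - rewrite sumR_const. destruct n; [simpl; nra|].
    assert (1 <= INR (S n)) by (rewrite S_INR; assert (Q := pos_INR n); lra). nra.
Qed.

(** * Deck transformations and the metric of K_n *)

(** In a triple [(b, v, a)], [b] tells whether the first [m] coordinates are reflected, [v]
    translates them, and the last coordinate moves by [2 a], plus 1 for a reflection: normal forms
    in the group generated by the steps. *)
Definition deck := (bool * (nat -> Z) * Z)%type.

Definition act (m : nat) (g : deck) (x : vec) : vec :=
  let '(b, v, a) := g in
  fun j => if Nat.ltb j m then (if b then IZR (v j) - x j else IZR (v j) + x j)
           else if Nat.eqb j m then x j + 2 * IZR a + (if b then 1 else 0) else x j.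

Ltac coords j m :=
  apply functional_extensionality; intros j; unfold act;
  destruct (Nat.ltb_spec j m); [|destruct (Nat.eqb_spec j m)].

Lemma act_one m x : act m (false, fun _ => 0%Z, 0%Z) x = x.
Proof. coords j m; cbn; ring. Qed.

Lemma act_comp m g h : exists k, forall x, act m g (act m h x) = act m k x.
Proof.
  destruct g as [[b v] a], h as [[b' v'] a'].
  exists (xorb b b', fun j => if b then (v j - v' j)%Z else (v j + v' j)%Z,
          (a + a' + (if andb b b' then 1 else 0))%Z).
  intros x. coords j m; destruct b, b'; cbn [xorb andb];
    rewrite ?plus_IZR, ?minus_IZR; cbn; ring.
Qed.

Lemma act_inv m g : exists h, forall x, act m h (act m g x) = x /\ act m g (act m h x) = x.
Proof.
  destruct g as [[b v] a].
  exists (b, fun j => if b then v j else (- v j)%Z, (- a - (if b then 1 else 0))%Z).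
  intros x; split; coords j m; destruct b;
    rewrite ?minus_IZR, ?opp_IZR; cbn; ring.
Qed.

Lemma act_inRn m g x : inRn (S m) x -> inRn (S m) (act m g x).
Proof.
  destruct g as [[b v] a]. intros H i Hi. unfold act.
  destruct (Nat.ltb_spec i m); [lia|]. destruct (Nat.eqb_spec i m); [lia|]. auto.
Qed.

Lemma euclid_act m n g x y : euclid n (act m g x) (act m g y) = euclid n x y.
Proof.
  destruct g as [[b v] a]. unfold euclid. f_equal. apply sumR_ext. intros j _.
  unfold act. destruct (Nat.ltb j m); [destruct b|destruct (Nat.eqb j m)]; ring.
Qed.

Lemma act_seg m g x y r : act m g (seg x y r) = seg (act m g x) (act m g y) r.
Proof.
  destruct g as [[b v] a]. unfold seg. coords j m; try destruct b; ring.
Qed.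

(** By parity the shift of the last coordinate vanishes only for [b = false] and [a = 0]; then [v]
    vanishes below [m]. Its later entries are arbitrary, so the conclusion is about the action and
    not about [h]. *)
Lemma act_free m h x : act m h x = x -> forall w, act m h w = w.
Proof.
  destruct h as [[b v] a]. intros H w.
  assert (Hm : 2 * IZR a + (if b then 1 else 0) = 0).
  { assert (E := f_equal (fun f => f m) H). unfold act in E.
    rewrite Nat.ltb_irrefl, Nat.eqb_refl in E. lra. }
  assert (Hb : b = false /\ a = 0%Z).
  { destruct b.
    - assert (E : IZR (2 * a + 1) = 0) by (rewrite plus_IZR, mult_IZR; lra).
      apply eq_IZR in E. lia.
    - split; auto. apply eq_IZR. lra. }
  destruct Hb as [-> ->]. coords j m.
  - assert (E := f_equal (fun f => f j) H). unfold act in E.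
    destruct (Nat.ltb_spec j m); [|lia]. lra.
  - ring.
  - ring.
Qed.

Lemma Kequiv_act m x y : Kequiv (S m) x y -> exists g, y = act m g x.
Proof.
  induction 1 as [x y K|x|x y _ IH|x y z _ IH1 _ IH2]; [destruct K as [x i Hi|x]|..].
  - rewrite Nat.sub_1_r in Hi. cbn in Hi.
    exists (false, fun j => if Nat.eqb i j then 1%Z else 0%Z, 0%Z).
    coords j m; unfold unit_vec; destruct (Nat.eqb_spec i j); try lia; ring.
  - exists (true, fun _ => 1%Z, 0%Z). unfold glide. rewrite Nat.sub_1_r. cbn [Nat.pred].
    coords j m; ring.
  - exists (false, fun _ => 0%Z, 0%Z). symmetry; apply act_one.
  - destruct IH as [g ->]. destruct (act_inv m g) as [h Hh]. exists h. symmetry; apply Hh.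
  - destruct IH1 as [g ->], IH2 as [h ->]. destruct (act_comp m h g) as [k Hk]. exists k. apply Hk.
Qed.

Lemma Kequiv_eq n x y : x = y -> Kequiv n x y.
Proof. intros ->. apply rst_refl. Qed.

Lemma Kequiv_shift1 m i (z : Z) x : (i < m)%nat ->
  Kequiv (S m) x (fun j => if Nat.eqb i j then IZR z + x j else x j).
Proof.
  intros Hi.
  assert (N : forall k x, Kequiv (S m) x (fun j => if Nat.eqb i j then INR k + x j else x j)).
  { induction k; intros x0.
    - apply Kequiv_eq.
      apply functional_extensionality; intros j. destruct (Nat.eqb i j); cbn; ring.
    - eapply rst_trans; [apply IHk|].
      replace (fun j => if Nat.eqb i j then INR (S k) + x0 j else x0 j) with
        (fun j => (fun j => if Nat.eqb i j then INR k + x0 j else x0 j) j + unit_vec i j).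
      + apply rst_step. constructor. lia.
      + apply functional_extensionality; intros j. unfold unit_vec.
        destruct (Nat.eqb i j); rewrite ?S_INR; ring. }
  destruct (Z_le_gt_dec 0 z) as [Hz|Hz].
  - rewrite <- (Z2Nat.id z Hz), <- INR_IZR_INZ. apply N.
  - apply rst_sym.
    eapply rst_trans; [apply (N (Z.to_nat (- z)))|]. apply Kequiv_eq.
    apply functional_extensionality; intros j.
    destruct (Nat.eqb i j); auto.
    rewrite INR_IZR_INZ, Z2Nat.id, opp_IZR by lia. ring.
Qed.

Lemma Kequiv_shift m k (v : nat -> Z) x : (k <= m)%nat ->
  Kequiv (S m) x (fun j => if Nat.ltb j k then IZR (v j) + x j else x j).
Proof.
  induction k; intros Hk.
  - apply rst_refl.
  - eapply rst_trans; [apply IHk; lia|].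
    eapply rst_trans; [apply (Kequiv_shift1 m k (v k)); lia|].
    apply Kequiv_eq.
    apply functional_extensionality; intros j.
    destruct (Nat.eqb_spec k j), (Nat.ltb_spec j k), (Nat.ltb_spec j (S k)); try lia; subst; auto.
Qed.

Lemma Kequiv_last m (a : Z) x :
  Kequiv (S m) x (act m (false, fun _ => 0%Z, a) x).
Proof.
  assert (N : forall k x, Kequiv (S m) x (act m (false, fun _ => 0%Z, Z.of_nat k) x)).
  { induction k; intros x0.
    - cbn [Z.of_nat]. rewrite act_one. apply rst_refl.
    - eapply rst_trans; [apply IHk|]. eapply rst_trans; [apply rst_step, Kstep_gl|].
      eapply rst_trans; [apply rst_step, Kstep_gl|].
      apply Kequiv_eq.
      unfold glide. rewrite Nat.sub_1_r. cbn [Nat.pred]. rewrite Nat2Z.inj_succ.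
      coords j m; rewrite ?succ_IZR; ring. }
  destruct (Z_le_gt_dec 0 a) as [Hz|Hz].
  - rewrite <- (Z2Nat.id a Hz). apply N.
  - apply rst_sym. eapply rst_trans; [apply (N (Z.to_nat (- a)))|].
    rewrite Z2Nat.id by lia.
    apply Kequiv_eq.
    coords j m; rewrite ?opp_IZR; ring.
Qed.

Lemma act_Kequiv m g x : Kequiv (S m) x (act m g x).
Proof.
  destruct g as [[b v] a].
  assert (F : forall v x, Kequiv (S m) x (act m (false, v, a) x)).
  { intros w y. eapply rst_trans; [apply (Kequiv_shift m m w); lia|].
    eapply rst_trans; [apply (Kequiv_last m a)|].
    apply Kequiv_eq.
    coords j m; ring. }
  destruct b; [|apply F].
  eapply rst_trans; [apply rst_step, Kstep_gl|].
  eapply rst_trans; [apply (F (fun j => (v j - 1)%Z))|].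
  apply Kequiv_eq.
  unfold glide. rewrite Nat.sub_1_r. cbn [Nat.pred].
  coords j m; rewrite ?minus_IZR; ring.
Qed.

(** * Attainment of the minimum and the metric axioms *)

Definition nearZ (c : R) : Z := (up (c + / 2) - 1)%Z.

Lemma nearZ_spec c z : (c - IZR (nearZ c)) ^ 2 <= (c - IZR z) ^ 2.
Proof.
  unfold nearZ. destruct (archimed (c + / 2)) as [A B].
  set (w := (up (c + / 2) - 1)%Z).
  assert (W : IZR w = IZR (up (c + / 2)) - 1) by (unfold w; rewrite minus_IZR; ring).
  destruct (Z.lt_trichotomy z w) as [L|[->|L]]; [|lra|].
  - assert (L' : IZR z + 1 <= IZR w) by (rewrite <- plus_IZR; apply IZR_le; lia). nra.
  - assert (L' : IZR w + 1 <= IZR z) by (rewrite <- plus_IZR; apply IZR_le; lia). nra.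
Qed.

(** For fixed [b] the coordinates of the translate vary independently, so rounding each one is
    optimal; it remains to compare the two values of [b]. *)
Lemma closest_translate m x y : exists g, forall h,
  euclid (S m) x (act m g y) <= euclid (S m) x (act m h y).
Proof.
  assert (B : forall b, exists g, forall v a,
    euclid (S m) x (act m g y) <= euclid (S m) x (act m (b, v, a) y)).
  { intros b.
    exists (b, fun j => nearZ (if b then x j + y j else x j - y j),
            nearZ ((x m - y m - (if b then 1 else 0)) / 2)).
    intros v a. unfold euclid. apply sqrt_le_1_alt, sumR_le. intros i Hi. unfold act.
    destruct (Nat.ltb_spec i m).
    - assert (P := nearZ_spec (if b then x i + y i else x i - y i) (v i)).
      destruct b; [|];
        match goal with |- ?A <= ?C => match type of P with ?A' <= ?C' =>
          replace A with A' by ring; replace C with C' by ring; exact P end end.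
    - assert (i = m) by lia. subst i. rewrite Nat.eqb_refl.
      set (c := (x m - y m - (if b then 1 else 0)) / 2).
      assert (P := nearZ_spec c a).
      match goal with |- ?A <= ?C =>
        replace A with (4 * (c - IZR (nearZ c)) ^ 2) by (unfold c; field);
        replace C with (4 * (c - IZR a) ^ 2) by (unfold c; field) end. lra. }
  destruct (B true) as [g Hg], (B false) as [h Hh].
  destruct (Rle_dec (euclid (S m) x (act m g y)) (euclid (S m) x (act m h y))).
  - exists g. intros [[[] v] a]; [apply Hg|]. eapply Rle_trans; [eassumption|apply Hh].
  - exists h. intros [[[] v] a]; [|apply Hh].
    apply Rle_trans with (euclid (S m) x (act m g y)); [lra|apply Hg].
Qed.

(** [dK] is an [epsilon], meaningful because the minimum is attained. Moving the second point alone
    suffices, as deck transformations are isometries. *)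
Lemma dK_spec m x y : inRn (S m) x -> inRn (S m) y ->
  (exists g, dK (S m) x y = euclid (S m) x (act m g y)) /\
  (forall g, dK (S m) x y <= euclid (S m) x (act m g y)).
Proof.
  intros Hx Hy.
  assert (M : is_dK (S m) x y (dK (S m) x y)).
  { unfold dK. apply epsilon_spec. destruct (closest_translate m x y) as [g Hg].
    exists (euclid (S m) x (act m g y)). split.
    - exists x, (act m g y). repeat split; auto using act_inRn, act_Kequiv. apply rst_refl.
    - intros x1 y1 _ _ E1 E2.
      destruct (Kequiv_act m x x1 E1) as [h ->], (Kequiv_act m y y1 E2) as [k ->].
      destruct (act_inv m h) as [h' Hh'], (act_comp m h' k) as [l Hl].
      rewrite <- (euclid_act m (S m) h' (act m h x) (act m k y)). destruct (Hh' x) as [-> _].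
      rewrite Hl. apply Hg. }
  destruct M as [[x1 [y1 [_ [_ [E1 [E2 E]]]]]] L]. split.
  - destruct (Kequiv_act m x x1 E1) as [h ->], (Kequiv_act m y y1 E2) as [k ->].
    destruct (act_inv m h) as [h' Hh'], (act_comp m h' k) as [l Hl].
    exists l. rewrite <- E, <- (euclid_act m (S m) h' (act m h x) (act m k y)). destruct (Hh' x) as [-> _].
    rewrite Hl. reflexivity.
  - intros g. apply L; auto using act_inRn, act_Kequiv. apply rst_refl.
Qed.

Lemma dK_le m x y : inRn (S m) x -> inRn (S m) y -> dK (S m) x y <= euclid (S m) x y.
Proof.
  intros Hx Hy. destruct (dK_spec m x y Hx Hy) as [_ L].
  rewrite <- (act_one m y) at 2. apply L.
Qed.

Lemma dK_nonneg m x y : inRn (S m) x -> inRn (S m) y -> 0 <= dK (S m) x y.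
Proof.
  intros Hx Hy. destruct (dK_spec m x y Hx Hy) as [[g ->] _]. apply euclid_nonneg.
Qed.

Lemma dK_refl m x : inRn (S m) x -> dK (S m) x x = 0.
Proof.
  intros Hx. apply Rle_antisym; [|apply dK_nonneg; auto].
  rewrite <- (euclid_refl (S m) x). apply dK_le; auto.
Qed.

Lemma dK_act m h k x y : inRn (S m) x -> inRn (S m) y ->
  dK (S m) (act m h x) (act m k y) = dK (S m) x y.
Proof.
  assert (L : forall h k x y, inRn (S m) x -> inRn (S m) y ->
    dK (S m) x y <= dK (S m) (act m h x) (act m k y)).
  { clear. intros h k x y Hx Hy.
    destruct (dK_spec m (act m h x) (act m k y)) as [[g ->] _]; auto using act_inRn.
    destruct (act_inv m h) as [h' Hh'], (act_comp m g k) as [l Hl], (act_comp m h' l) as [l' Hl'].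
    rewrite <- (euclid_act m (S m) h' (act m h x)), Hl, Hl'. destruct (Hh' x) as [-> _].
    apply dK_spec; auto. }
  intros Hx Hy. apply Rle_antisym; [|apply L; auto].
  destruct (act_inv m h) as [h' Hh'], (act_inv m k) as [k' Hk'].
  rewrite <- (proj1 (Hh' x)) at 2. rewrite <- (proj1 (Hk' y)) at 2.
  apply L; auto using act_inRn.
Qed.

Lemma dK_sym m x y : inRn (S m) x -> inRn (S m) y -> dK (S m) x y = dK (S m) y x.
Proof.
  assert (L : forall x y, inRn (S m) x -> inRn (S m) y -> dK (S m) x y <= dK (S m) y x).
  { clear. intros x y Hx Hy. destruct (dK_spec m y x Hy Hx) as [[g ->] _].
    rewrite euclid_sym, <- (dK_act m g (false, fun _ => 0%Z, 0%Z)), act_one; auto.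
    apply dK_le; auto using act_inRn. }
  intros; apply Rle_antisym; auto.
Qed.

Lemma dK_triangle m x y z : inRn (S m) x -> inRn (S m) y -> inRn (S m) z ->
  dK (S m) x z <= dK (S m) x y + dK (S m) y z.
Proof.
  intros Hx Hy Hz. destruct (dK_spec m x y Hx Hy) as [[g Hg] _].
  rewrite <- (dK_act m g (false, fun _ => 0%Z, 0%Z) y z), act_one, Hg; auto.
  destruct (dK_spec m (act m g y) z) as [[h Hh] _]; auto using act_inRn.
  rewrite Hh. destruct (dK_spec m x z Hx Hz) as [_ L].
  eapply Rle_trans; [apply (L h)|]. apply euclid_triangle.
Qed.

Lemma dK_eq0 m x y : inRn (S m) x -> inRn (S m) y -> dK (S m) x y = 0 ->
  exists g, y = act m g x.
Proof.
  intros Hx Hy E. destruct (dK_spec m x y Hx Hy) as [[g Hg] _]. rewrite E in Hg.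
  symmetry in Hg. apply euclid_eq0 in Hg; auto using act_inRn.
  destruct (act_inv m g) as [h Hh]. exists h. rewrite Hg. symmetry. apply Hh.
Qed.

(** * Minimal geodesics and their continuous choices *)

Definition minimizer (m : nat) (x y : vec) (g : deck) : Prop :=
  euclid (S m) x (act m g y) = dK (S m) x y.

(** Lift [P], [Q] and [y] in turn, each as close as possible to the lift before. The broken line is
    no longer than [dK (S m) x y], so the triangle inequalities are equalities and the lifts lie on
    one segment. *)
Lemma broken_geodesic_lift m x y P Q :
  inRn (S m) x -> inRn (S m) y -> inRn (S m) P -> inRn (S m) Q -> 0 < dK (S m) x y ->
  dK (S m) x P + dK (S m) P Q + dK (S m) Q y <= dK (S m) x y ->
  exists g, minimizer m x y g /\
    (exists h, P = act m h (seg x (act m g y) (dK (S m) x P / dK (S m) x y))) /\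
    (exists h, Q = act m h (seg x (act m g y) (dK (S m) x Q / dK (S m) x y))).
Proof.
  intros Hx Hy HP HQ D L.
  destruct (dK_spec m x P Hx HP) as [[h1 E1] _]. set (A := act m h1 P) in *.
  assert (HA : inRn (S m) A) by (apply act_inRn; auto).
  assert (E2' : dK (S m) P Q = dK (S m) A Q).
  { rewrite <- (dK_act m h1 (false, fun _ => 0%Z, 0%Z)), act_one; auto. }
  destruct (dK_spec m A Q HA HQ) as [[h2 E2] _]. set (B := act m h2 Q) in *.
  assert (HB : inRn (S m) B) by (apply act_inRn; auto).
  assert (E3' : dK (S m) Q y = dK (S m) B y).
  { rewrite <- (dK_act m h2 (false, fun _ => 0%Z, 0%Z)), act_one; auto. }
  destruct (dK_spec m B y HB Hy) as [[g E3] _]. set (Y := act m g y) in *.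
  assert (HY : inRn (S m) Y) by (apply act_inRn; auto).
  rewrite E2', E2, E3', E3, E1 in L.
  assert (T1 := euclid_triangle (S m) x A Y).
  assert (T2 := euclid_triangle (S m) A B Y).
  assert (T3 := euclid_triangle (S m) x B Y).
  assert (T4 := euclid_triangle (S m) x A B).
  assert (M : dK (S m) x y <= euclid (S m) x Y) by (apply dK_spec; auto).
  assert (TQ := dK_triangle m x Q y Hx HQ Hy).
  assert (LQ : dK (S m) x Q <= euclid (S m) x B) by (apply dK_spec; auto).
  assert (EY : euclid (S m) x Y = dK (S m) x y) by lra.
  exists g. split; [exact EY|]. fold Y. rewrite <- EY. split.
  - destruct (act_inv m h1) as [k Hk]. exists k. rewrite E1.
    rewrite <- (euclid_between (S m) x A Y); auto; try lra.
    symmetry; apply Hk.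
  - destruct (act_inv m h2) as [k Hk]. exists k.
    replace (dK (S m) x Q) with (euclid (S m) x B) by lra.
    rewrite <- (euclid_between (S m) x B Y); auto; try lra.
    symmetry; apply Hk.
Qed.

(** Minimal geodesics do not branch. Going from [x] to [A] and on to [Y] along the other segment is
    again minimal, hence straight, so [Y] is [act m g' y]. Comparison with the segment from
    [act m h x] to [Y] shows that [h] fixes [x], and the action is free. *)
Lemma seg_interior_unique m x y g g' h r :
  inRn (S m) x -> inRn (S m) y -> 0 < dK (S m) x y -> 0 < r < 1 ->
  minimizer m x y g -> minimizer m x y g' ->
  act m h (seg x (act m g y) r) = seg x (act m g' y) r -> act m g y = act m g' y.
Proof.
  unfold minimizer. intros Hx Hy D Hr M M' E.
  set (d := dK (S m) x y) in *.
  assert (S0 : forall u w, seg u w 0 = u)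
    by (intros; apply functional_extensionality; intros; unfold seg; ring).
  assert (S1 : forall u w, seg u w 1 = w)
    by (intros; apply functional_extensionality; intros; unfold seg; ring).
  set (Y := act m h (act m g y)).
  set (A := seg x (act m g' y) r) in *.
  assert (HY : inRn (S m) Y) by (repeat apply act_inRn; auto).
  assert (Hg : inRn (S m) (act m g y)) by (apply act_inRn; auto).
  assert (Hg' : inRn (S m) (act m g' y)) by (apply act_inRn; auto).
  assert (HA : inRn (S m) A) by (apply seg_inRn; auto).
  assert (Hhx : inRn (S m) (act m h x)) by (apply act_inRn; auto).
  assert (D1 : euclid (S m) x A = r * d).
  { unfold A. rewrite <- (S0 x (act m g' y)) at 1. rewrite euclid_seg, M', Rabs_left by lra. ring. }
  assert (D2 : euclid (S m) A Y = (1 - r) * d).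
  { rewrite <- E. unfold Y. rewrite euclid_act. rewrite <- (S1 x (act m g y)) at 2.
    rewrite euclid_seg, M, Rabs_left by lra. ring. }
  assert (D3 : euclid (S m) (act m h x) A = r * d).
  { rewrite <- E, euclid_act. rewrite <- (S0 x (act m g y)) at 1.
    rewrite euclid_seg, M, Rabs_left by lra. ring. }
  assert (D4 : euclid (S m) x Y = d).
  { apply Rle_antisym.
    - eapply Rle_trans; [apply euclid_triangle with (y := A)|]. lra.
    - destruct (act_comp m h g) as [k Hk]. unfold Y. rewrite Hk. apply dK_spec; auto. }
  assert (D5 : euclid (S m) (act m h x) Y = d) by (unfold Y; rewrite euclid_act; auto).
  assert (F1 := euclid_between (S m) x A Y Hx HA HY ltac:(lra) ltac:(lra)).
  rewrite D1, D4 in F1. replace (r * d / d) with r in F1 by (field; lra).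
  assert (F2 := euclid_between (S m) (act m h x) A Y Hhx HA HY ltac:(lra) ltac:(lra)).
  rewrite D3, D5 in F2. replace (r * d / d) with r in F2 by (field; lra).
  assert (YE : Y = act m g' y).
  { apply functional_extensionality; intros j. assert (Q := f_equal (fun f => f j) F1).
    unfold A, seg in Q. nra. }
  assert (HX : act m h x = x).
  { apply functional_extensionality; intros j.
    assert (Q := f_equal (fun f => f j) F1). assert (Q2 := f_equal (fun f => f j) F2).
    cbv beta in Q, Q2. unfold seg in Q, Q2. nra. }
  rewrite <- YE. unfold Y. symmetry. apply (act_free m h x HX).
Qed.

(** The path is the projection of the segment from [x] to [act m g y]. Its speed may vary, so the
    position on the segment is read off from the distance to [x]. *)
Definition follows (m : nat) (gam : R -> vec) (x y : vec) (g : deck) : Prop :=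
  minimizer m x y g /\ forall t, 0 <= t <= 1 -> exists h,
    gam t = act m h (seg x (act m g y) (dK (S m) x (gam t) / dK (S m) x y)).

Lemma follows_act m gam x y g g' : act m g y = act m g' y ->
  follows m gam x y g -> follows m gam x y g'.
Proof. intros E [M F]. unfold follows, minimizer in *. rewrite <- E. split; auto. Qed.

Section Geodesic.
Variables (m : nat) (gam : R -> vec) (x y : vec).
Hypotheses (Hx : inRn (S m) x) (Hy : inRn (S m) y) (D : 0 < dK (S m) x y)
  (MG : min_geod (S m) gam) (G0 : Kequiv (S m) (gam 0) x) (G1 : Kequiv (S m) (gam 1) y).

Lemma geod_in t : 0 <= t <= 1 -> inRn (S m) (gam t).
Proof. apply MG. Qed.

Lemma geod_dist0 z : inRn (S m) z -> dK (S m) (gam 0) z = dK (S m) x z.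
Proof.
  intros Hz. destruct (Kequiv_act m _ _ G0) as [g Eg].
  rewrite Eg, <- (dK_act m g (false, fun _ => 0%Z, 0%Z) (gam 0) z), act_one; auto.
  apply geod_in; lra.
Qed.

Lemma geod_dist1 z : inRn (S m) z -> dK (S m) z (gam 1) = dK (S m) z y.
Proof.
  intros Hz. destruct (Kequiv_act m _ _ G1) as [g Eg].
  rewrite Eg, <- (dK_act m (false, fun _ => 0%Z, 0%Z) g z (gam 1)), act_one; auto.
  apply geod_in; lra.
Qed.

Lemma geod_sum s t : 0 <= s -> s <= t -> t <= 1 ->
  dK (S m) x (gam s) + dK (S m) (gam s) (gam t) + dK (S m) (gam t) y <= dK (S m) x y.
Proof.
  intros H1 H2 H3. destruct MG as [_ [U _]].
  assert (I0 := geod_in 0 ltac:(lra)). assert (I1 := geod_in 1 ltac:(lra)).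
  rewrite <- geod_dist0, <- (geod_dist1 (gam t)), <- geod_dist0, <- (geod_dist1 (gam 0));
    auto; try (apply geod_in; lra).
  apply U. exists 3%nat, (fun i => match i with O => 0 | 1%nat => s | 2%nat => t | _ => 1 end).
  repeat split; auto.
  - intros [|[|[|i]]] Hi; try lra; lia.
  - cbn. ring.
Qed.

(* Elements of GK_n need not have constant speed, so half of the distance is reached at a time
   given by the intermediate value theorem. *)
Lemma geod_half : exists t, 0 <= t <= 1 /\ dK (S m) x (gam t) = dK (S m) x y / 2.
Proof.
  (* Time is clamped to the unit interval because [IVT] asks for continuity on all of [R]. *)
  set (cl := fun t => Rmax 0 (Rmin t 1)).
  assert (C01 : forall t, 0 <= cl t <= 1).
  { intros t. unfold cl. split; [apply Rmax_l|]. apply Rmax_lub; [lra|apply Rmin_r]. }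
  assert (Cid : forall t, 0 <= t <= 1 -> cl t = t).
  { intros t Ht. unfold cl. rewrite Rmin_left, Rmax_right; lra. }
  assert (Clip : forall s t, Rabs (cl s - cl t) <= Rabs (s - t)).
  { intros s t. unfold cl, Rmax, Rmin.
    repeat destruct Rle_dec; unfold Rabs; repeat destruct Rcase_abs; lra. }
  set (f := fun t => dK (S m) x (gam (cl t)) - dK (S m) x y / 2).
  assert (Cf : continuity f).
  { intros t eps He. destruct MG as [[_ Cg] _].
    destruct (Cg (cl t) (C01 t) eps He) as [del [Hd HD]].
    exists del. split; auto. intros s [_ Hs]. cbn in *. unfold Rdist in *.
    assert (A := geod_in _ (C01 t)). assert (B := geod_in _ (C01 s)).
    assert (L : dK (S m) (gam (cl t)) (gam (cl s)) < eps).
    { apply HD; auto. eapply Rle_lt_trans; [apply Clip|]. rewrite Rabs_minus_sym; auto. }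
    assert (T1 := dK_triangle m x _ _ Hx A B).
    assert (T2 := dK_triangle m x _ _ Hx B A).
    rewrite (dK_sym m (gam (cl s))) in T2 by auto.
    unfold f. apply Rabs_def1; lra. }
  assert (I0 := geod_in 0 ltac:(lra)). assert (I1 := geod_in 1 ltac:(lra)).
  assert (Z0 : dK (S m) x (gam 0) = 0).
  { rewrite <- geod_dist0 by auto. apply dK_refl; auto. }
  destruct (IVT f 0 1 Cf) as [t [Ht Et]]; try lra.
  - unfold f. rewrite Cid, Z0 by lra. lra.
  - unfold f. rewrite Cid, geod_dist1 by (auto; lra). lra.
  - exists t. split; auto. unfold f in Et. rewrite Cid in Et by auto. lra.
Qed.

(** Any two times have a common minimizer by lifting. With one of them fixed at the half-way point,
    these minimizers all agree by [seg_interior_unique]. *)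
Lemma follows_exists : exists g, follows m gam x y g.
Proof.
  destruct geod_half as [t0 [Ht0 E0]].
  assert (two : forall s t, 0 <= s <= 1 -> 0 <= t <= 1 -> exists g, minimizer m x y g /\
    (exists h, gam s = act m h (seg x (act m g y) (dK (S m) x (gam s) / dK (S m) x y))) /\
    (exists h, gam t = act m h (seg x (act m g y) (dK (S m) x (gam t) / dK (S m) x y)))).
  { intros s t Hs Ht. destruct (Rle_dec s t) as [L|L].
    - apply broken_geodesic_lift; auto using geod_in. apply geod_sum; lra.
    - destruct (broken_geodesic_lift m x y (gam t) (gam s)) as [g [M [P Q]]];
        auto using geod_in; [apply geod_sum; lra|].
      exists g. auto. }
  destruct (two t0 t0 Ht0 Ht0) as [g [M [[h Eh] _]]].
  exists g. split; auto. intros t Ht.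
  destruct (two t0 t Ht0 Ht) as [g' [M' [[h' Eh'] P]]].
  replace (act m g y) with (act m g' y); auto.
  rewrite E0 in Eh, Eh'. replace (dK (S m) x y / 2 / dK (S m) x y) with (/ 2) in * by (field; lra).
  destruct (act_inv m h) as [k Hk], (act_comp m k h') as [l Hl].
  apply (seg_interior_unique m x y g' g l (/ 2)); auto; try lra.
  rewrite <- Hl, <- Eh', Eh. apply Hk.
Qed.

Lemma follows_unique g g' : follows m gam x y g -> follows m gam x y g' ->
  act m g y = act m g' y.
Proof.
  intros [M F] [M' F']. destruct geod_half as [t0 [Ht0 E0]].
  destruct (F t0 Ht0) as [h Eh], (F' t0 Ht0) as [h' Eh'].
  rewrite E0 in Eh, Eh'. replace (dK (S m) x y / 2 / dK (S m) x y) with (/ 2) in * by (field; lra).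
  destruct (act_inv m h') as [k Hk], (act_comp m k h) as [l Hl].
  apply (seg_interior_unique m x y g g' l (/ 2)); auto; try lra.
  rewrite <- Hl, <- Eh, Eh'. apply Hk.
Qed.

End Geodesic.

(** * Continuity of sections *)

Lemma Rabs_le_bounds a b : Rabs a <= b -> - b <= a <= b.
Proof. unfold Rabs. destruct (Rcase_abs a); lra. Qed.

Lemma openK_ball m z e : inRn (S m) z -> openK (S m) (fun w => inRn (S m) w /\ dK (S m) z w < e).
Proof.
  intros Hz w Hw [_ Lw]. exists (e - dK (S m) z w). split; [lra|].
  intros w' Hw' L. split; auto.
  assert (T := dK_triangle m z w w' Hz Hw Hw'). lra.
Qed.

Lemma compact_point t : compact (fun c => t <= c <= t).
Proof. apply compact_P3. Qed.

Lemma section_near m E s p t e : cont_section (S m) E s -> inKK (S m) p -> E p ->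
  0 <= t <= 1 -> 0 < e -> exists delta, 0 < delta /\
  forall q, inKK (S m) q -> E q -> dKK (S m) p q < delta -> dK (S m) (s p t) (s q t) < e.
Proof.
  intros [C1 C2] Hp Ep Ht He.
  assert (I : inRn (S m) (s p t)) by (apply C1; auto).
  destruct (C2 (fun c => t <= c <= t) (fun w => inRn (S m) w /\ dK (S m) (s p t) w < e))
    with (p := p) as [del [Hd HD]]; auto using compact_point, openK_ball.
  - intros; lra.
  - intros c Hc. replace c with t by lra. split; auto.
    rewrite dK_refl; auto.
  - exists del. split; auto. intros q Hq Eq L. apply (HD q Hq Eq L t). lra.
Qed.

(** A section is given on representatives; those of the same point are at distance 0, so continuity
    makes the values agree up to a deck transformation. *)
Lemma section_class m E s p q t : cont_section (S m) E s -> inKK (S m) p -> E p ->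
  inKK (S m) q -> E q -> dKK (S m) p q = 0 -> 0 <= t <= 1 ->
  exists k, s q t = act m k (s p t).
Proof.
  intros CS Hp Ep Hq Eq Z Ht.
  assert (I : inRn (S m) (s p t)) by (apply CS; auto).
  assert (I' : inRn (S m) (s q t)) by (apply CS; auto).
  apply dK_eq0; auto. apply Rle_antisym; [|apply dK_nonneg; auto].
  apply Rle_plus_epsilon. intros e He.
  destruct (section_near m E s p t e CS Hp Ep Ht He) as [del [Hd HD]].
  assert (L := HD q Hq Eq ltac:(lra)). lra.
Qed.

(* The half-way point of the geodesic at [p] separates the homotopy classes; compact-open
   continuity is only needed at the corresponding time. *)
Lemma not_follows_near m E s x y g0 g : cont_section (S m) E s ->
  inRn (S m) x -> inRn (S m) y -> E (x, y) -> 0 < dK (S m) x y ->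
  follows m (s (x, y)) x y g0 -> act m g y <> act m g0 y ->
  exists delta, 0 < delta /\ forall x' y', inRn (S m) x' -> inRn (S m) y' -> E (x', y') ->
    euclid (S m) x x' < delta -> euclid (S m) y y' < delta ->
    ~ follows m (s (x', y')) x' y' g.
Proof.
  intros CS Hx Hy Ep D F0 Ng.
  assert (Hp : inKK (S m) (x, y)) by (split; auto).
  set (d := dK (S m) x y) in *.
  assert (Dd : forall x' y', inRn (S m) x' -> inRn (S m) y' ->
     Rabs (d - dK (S m) x' y') <= euclid (S m) x x' + euclid (S m) y y').
  { intros x' y' Hx' Hy'.
    assert (A1 := dK_triangle m x x' y Hx Hx' Hy). assert (A2 := dK_triangle m x' y' y Hx' Hy' Hy).
    assert (A3 := dK_triangle m x' x y' Hx' Hx Hy'). assert (A4 := dK_triangle m x y y' Hx Hy Hy').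
    rewrite (dK_sym m y' y) in A2 by auto. rewrite (dK_sym m x' x) in A3 by auto.
    assert (B1 := dK_le m x x' Hx Hx'). assert (B2 := dK_le m y y' Hy Hy').
    apply Rabs_le. unfold d. lra. }
  assert (De : forall x' y', Rabs (euclid (S m) x (act m g y) - euclid (S m) x' (act m g y'))
     <= euclid (S m) x x' + euclid (S m) y y').
  { intros x' y'.
    assert (A1 := euclid_triangle (S m) x x' (act m g y)).
    assert (A2 := euclid_triangle (S m) x' (act m g y') (act m g y)).
    assert (A3 := euclid_triangle (S m) x' x (act m g y')).
    assert (A4 := euclid_triangle (S m) x (act m g y) (act m g y')).
    rewrite euclid_act in A2, A4. rewrite (euclid_sym _ y' y) in A2.
    rewrite (euclid_sym _ x' x) in A3. apply Rabs_le. lra. }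
  (* If [g] is minimal at [(x, y)], its midpoint differs from that of the actual geodesic; otherwise
     the excess length persists nearby. *)
  destruct (Req_dec (euclid (S m) x (act m g y)) d) as [M|M].
  - destruct (CS) as [C1 _]. destruct (C1 (x, y) Hp Ep) as [MG [G0 G1]]. cbn [fst snd] in G0, G1.
    destruct (geod_half m (s (x, y)) x y) as [t0 [Ht0 E0]]; auto. fold d in E0.
    destruct F0 as [M0 F0]. destruct (F0 t0 Ht0) as [h Eh]. rewrite E0 in Eh.
    fold d in Eh. replace (d / 2 / d) with (/ 2) in Eh by (field; lra).
    set (P := s (x, y) t0) in *.
    assert (HP : inRn (S m) P) by (apply MG; auto).
    set (P' := seg x (act m g y) (/ 2)).
    assert (HP' : inRn (S m) P') by (apply seg_inRn; auto using act_inRn).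
    assert (Sep : 0 < dK (S m) P P').
    { destruct (dK_nonneg m P P' HP HP') as [L|L]; auto. exfalso. symmetry in L.
      destruct (dK_eq0 m P P' HP HP' L) as [k Ek]. rewrite Eh in Ek.
      destruct (act_comp m k h) as [l Hl]. rewrite Hl in Ek.
      apply Ng. symmetry. apply (seg_interior_unique m x y g0 g l (/ 2)); auto; lra. }
    (* If a nearby geodesic followed [g], the estimates below would give [dK (S m) P P' < 3 * e]. *)
    set (e := dK (S m) P P' / 4).
    destruct (section_near m E s (x, y) t0 e CS Hp Ep Ht0 ltac:(unfold e; lra)) as [d1 [Hd1 N1]].
    exists (Rmin (d1 / 4) (Rmin (e / 4) (d / 4))). split.
    { unfold e. repeat apply Rmin_pos; lra. }
    intros x' y' Hx' Hy' Eq Lx Ly [M' F'].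
    assert (B1 := Rmin_l (d1 / 4) (Rmin (e / 4) (d / 4))).
    assert (B2 := Rmin_r (d1 / 4) (Rmin (e / 4) (d / 4))).
    assert (B3 := Rmin_l (e / 4) (d / 4)). assert (B4 := Rmin_r (e / 4) (d / 4)).
    set (del := Rmin (d1 / 4) (Rmin (e / 4) (d / 4))) in *.
    assert (Hq : inKK (S m) (x', y')) by (split; auto).
    assert (LQ : dK (S m) P (s (x', y') t0) < e).
    { apply N1; auto. unfold dKK. cbn.
      assert (C3 := dK_le m x x' Hx Hx'). assert (C4 := dK_le m y y' Hy Hy'). lra. }
    set (Q := s (x', y') t0) in *.
    destruct (C1 (x', y') Hq Eq) as [MG' [G0' G1']]. cbn [fst snd] in G0', G1'.
    assert (HQ : inRn (S m) Q) by (apply MG'; auto).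
    assert (Dd' := Dd x' y' Hx' Hy'). set (d' := dK (S m) x' y') in *.
    assert (Pd : 0 < d').
    { apply Rabs_le_bounds in Dd'. lra. }
    destruct (F' t0 Ht0) as [k Ek]. fold Q d' in Ek. set (r := dK (S m) x' Q / d') in *.
    assert (C5 : dK (S m) Q P' <= euclid (S m) (seg x' (act m g y') r) P').
    { rewrite Ek, <- (act_one m P') at 1. rewrite dK_act; auto using seg_inRn, act_inRn.
      apply dK_le; auto using seg_inRn, act_inRn. }
    assert (C6 := euclid_triangle (S m) (seg x' (act m g y') r) (seg x' (act m g y') (/ 2)) P').
    rewrite euclid_seg, M' in C6. fold d' in C6.
    assert (C7 : euclid (S m) (seg x' (act m g y') (/ 2)) P' <=
       euclid (S m) x' x + euclid (S m) (act m g y') (act m g y)).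
    { apply euclid_seg2; lra. }
    rewrite euclid_act, (euclid_sym _ x' x), (euclid_sym _ y' y) in C7.
    assert (C8 : Rabs (r - / 2) * d' = Rabs (dK (S m) x' Q - d' / 2)).
    { rewrite <- (Rabs_right d') at 1 by lra. rewrite <- Rabs_mult. f_equal.
      unfold r. field. lra. }
    assert (A1 := dK_triangle m x' x Q Hx' Hx HQ). assert (A2 := dK_triangle m x P Q Hx HP HQ).
    assert (A3 := dK_triangle m x x' P Hx Hx' HP). assert (A4 := dK_triangle m x' Q P Hx' HQ HP).
    rewrite (dK_sym m x' x) in A1 by auto. rewrite (dK_sym m Q P) in A4 by auto.
    assert (A5 := dK_le m x x' Hx Hx').
    assert (A6 := dK_triangle m P Q P' HP HQ HP').
    assert (C9 : Rabs (dK (S m) x' Q - d' / 2) <= 2 * del + e).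
    { apply Rabs_le_bounds in Dd'. apply Rabs_le. lra. }
    unfold e in *. lra.
  - assert (Hg : d <= euclid (S m) x (act m g y)) by (apply dK_spec; auto).
    exists ((euclid (S m) x (act m g y) - d) / 4). split; [lra|].
    intros x' y' Hx' Hy' _ Lx Ly [M' _]. unfold minimizer in M'.
    assert (A1 := Dd x' y' Hx' Hy'). assert (A2 := De x' y').
    apply Rabs_le_bounds in A1. apply Rabs_le_bounds in A2. lra.
Qed.

(** * A neighbourhood of the deepest stratum *)

(* Small enough that |t - 1/2| >= 1/8 decides between the two cubes whatever u and w are. *)
Definition kap (m : nat) : R := / (16 * INR m).

(** Together with [ptY], solved from [u_j = 1/2 + kap z_j], [w_j = 1/2 + kap z_(m+j)],
    [t = 1/2 + z_(2m) / 4], with [z_(2m+1)] the last coordinate of the second point. *)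
Definition ptX (m : nat) (z : vec) : vec := fun j =>
  if Nat.ltb j m then (1 + kap m * z j + kap m * z (m + j)%nat) / 2
  else if Nat.eqb j m then z (2 * m + 1)%nat + / 2 + z (2 * m)%nat / 4 else 0.

Definition ptY (m : nat) (z : vec) : vec := fun j =>
  if Nat.ltb j m then kap m * (z (m + j)%nat - z j) / 2
  else if Nat.eqb j m then z (2 * m + 1)%nat else 0.

(** The coordinate [2 * m + 1] along the circle stays free, so that [turn] preserves the box. *)
Definition box (m : nat) (z : vec) : Prop :=
  forall i, (i <= 2 * m)%nat -> -1 <= z i <= 1.

Lemma ptX_inRn m z : inRn (S m) (ptX m z).
Proof.
  intros i Hi. unfold ptX.
  destruct (Nat.ltb_spec i m); [lia|]. destruct (Nat.eqb_spec i m); [lia|auto].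
Qed.

Lemma ptY_inRn m z : inRn (S m) (ptY m z).
Proof.
  intros i Hi. unfold ptY.
  destruct (Nat.ltb_spec i m); [lia|]. destruct (Nat.eqb_spec i m); [lia|auto].
Qed.

Lemma kap_bounds m : (1 <= m)%nat -> 0 < kap m <= / 16 /\ INR m * kap m = / 16.
Proof.
  intros Hm. unfold kap.
  assert (1 <= INR m) by (replace 1 with (INR 1) by reflexivity; apply le_INR; auto).
  split; [split|].
  - apply Rinv_0_lt_compat; lra.
  - apply Rinv_le_contravar; lra.
  - field; lra.
Qed.

(** * Minimizers near the circle *)

(** The squared distance is a sum over coordinates, so a competitor altered in one coordinate tests
    that coordinate alone. *)
Lemma minimizer_coord m x y g g' i : inRn (S m) x -> inRn (S m) y ->
  minimizer m x y g -> (i <= m)%nat ->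
  (forall j, (j <= m)%nat -> j <> i -> act m g' y j = act m g y j) ->
  (x i - act m g y i) ^ 2 <= (x i - act m g' y i) ^ 2.
Proof.
  intros Hx Hy M Hi E. unfold minimizer in M.
  apply Rnot_lt_le. intros L.
  assert (Q : dK (S m) x y <= euclid (S m) x (act m g' y)) by (apply dK_spec; auto).
  rewrite <- M in Q. unfold euclid in Q. apply sqrt_le_0 in Q; try apply sumsq_nonneg.
  revert Q. apply Rlt_not_le.
  apply (sumR_lt (S m) _ _ i); auto; [|lia].
  intros j Hj. destruct (Nat.eq_dec j i) as [->|N]; [apply Rlt_le; exact L|].
  rewrite E by (auto; lia). lra.
Qed.

(* The deviation from 1/2 of u_j ([b = false]) or w_j ([b = true]). *)
Definition offset (m : nat) (z : vec) (b : bool) (j : nat) : R :=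
  kap m * z (if b then m + j else j)%nat.

Lemma diff_coord m z b v a j : (j < m)%nat ->
  ptX m z j - act m (b, v, a) (ptY m z) j = / 2 + offset m z b j - IZR (v j).
Proof.
  intros Hj. unfold act, ptX, ptY, offset.
  destruct (Nat.ltb_spec j m); [|lia]. destruct b; field.
Qed.

Lemma diff_last m z b v a :
  ptX m z m - act m (b, v, a) (ptY m z) m =
  / 2 + z (2 * m)%nat / 4 - (if b then 1 else 0) - 2 * IZR a.
Proof.
  unfold act, ptX, ptY. rewrite Nat.ltb_irrefl, Nat.eqb_refl. destruct b; field.
Qed.

Lemma offset_bound m z b j : (1 <= m)%nat -> box m z -> (j < m)%nat ->
  - kap m <= offset m z b j <= kap m.
Proof.
  intros Hm Bz Hj. unfold offset. destruct (kap_bounds m Hm) as [K _].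
  assert (B : -1 <= z (if b then m + j else j)%nat <= 1) by (apply Bz; destruct b; lia). nra.
Qed.

Lemma minimizer_bit m z b v a j : (1 <= m)%nat -> box m z ->
  minimizer m (ptX m z) (ptY m z) (b, v, a) -> (j < m)%nat ->
  (v j = 0%Z \/ v j = 1%Z) /\
  (0 < offset m z b j -> v j = 1%Z) /\ (offset m z b j < 0 -> v j = 0%Z).
Proof.
  intros Hm Bz M Hj.
  assert (C : forall w : Z, (/ 2 + offset m z b j - IZR (v j)) ^ 2 <=
                            (/ 2 + offset m z b j - IZR w) ^ 2).
  { intros w.
    assert (P := minimizer_coord m _ _ (b, v, a)
      (b, fun i => if Nat.eqb i j then w else v i, a) j
      (ptX_inRn m z) (ptY_inRn m z) M ltac:(lia)).
    rewrite !diff_coord in P by auto. rewrite Nat.eqb_refl in P. apply P.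
    intros i Hi N. unfold act. destruct (Nat.eqb_spec i j); [lia|auto]. }
  assert (B := offset_bound m z b j Hm Bz Hj). destruct (kap_bounds m Hm) as [K _].
  assert (C0 := C 0%Z). assert (C1 := C 1%Z).
  set (th := offset m z b j) in *.
  assert (V : v j = 0%Z \/ v j = 1%Z).
  { destruct (Z_le_gt_dec 2 (v j)) as [L|L].
    - apply IZR_le in L. nra.
    - destruct (Z_le_gt_dec (v j) (-1)) as [L'|L'].
      + apply IZR_le in L'. nra.
      + lia. }
  repeat split; auto.
  - intros P. destruct V as [V|V]; auto. rewrite V in C1. nra.
  - intros P. destruct V as [V|V]; auto. rewrite V in C0. nra.
Qed.

Lemma minimizer_last m z b v a : (1 <= m)%nat -> box m z ->
  minimizer m (ptX m z) (ptY m z) (b, v, a) -> a = 0%Z.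
Proof.
  intros Hm Bz M.
  assert (P := minimizer_coord m _ _ (b, v, a) (b, v, 0%Z) m
    (ptX_inRn m z) (ptY_inRn m z) M ltac:(lia)).
  rewrite !diff_last in P.
  assert (C := P ltac:(intros j Hj N; unfold act; destruct (Nat.ltb_spec j m); auto; lia)).
  assert (B := Bz (2 * m)%nat ltac:(lia)). set (t := z (2 * m)%nat) in *.
  destruct (Z_le_gt_dec 1 a) as [L|L].
  - apply IZR_le in L. destruct b; nra.
  - destruct (Z_le_gt_dec a (-1)) as [L'|L'].
    + apply IZR_le in L'. destruct b; nra.
    + lia.
Qed.

(** Switching to a translate of the other kind costs at most [2 m kap = 1/8] in the first [m]
    coordinates of the squared distance; on the wrong side it would gain at least [1/4] in the last
    one. *)
Lemma minimizer_side m z b v a : (1 <= m)%nat -> box m z ->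
  minimizer m (ptX m z) (ptY m z) (b, v, a) ->
  (/ 2 <= z (2 * m)%nat -> b = true) /\ (z (2 * m)%nat <= - / 2 -> b = false).
Proof.
  intros Hm Bz M.
  assert (A0 := minimizer_last m z b v a Hm Bz M). subst a.
  assert (Q : dK (S m) (ptX m z) (ptY m z) <=
     euclid (S m) (ptX m z) (act m (negb b, fun _ => 1%Z, 0%Z) (ptY m z)))
    by (apply dK_spec; auto using ptX_inRn, ptY_inRn).
  rewrite <- M in Q. unfold euclid in Q. apply sqrt_le_0 in Q; try apply sumsq_nonneg.
  cbn [sumR] in Q. rewrite !diff_last in Q.
  destruct (kap_bounds m Hm) as [K KS].
  assert (L1 : INR m * (/ 2 - kap m) ^ 2 <=
     sumR m (fun i => (ptX m z i - act m (b, v, 0%Z) (ptY m z) i) ^ 2)).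
  { rewrite <- sumR_const. apply sumR_le. intros j Hj. rewrite diff_coord by auto.
    assert (B := offset_bound m z b j Hm Bz Hj).
    destruct (minimizer_bit m z b v 0 j Hm Bz M Hj) as [[-> | ->] _]; nra. }
  assert (L2 : sumR m (fun i => (ptX m z i - act m (negb b, fun _ => 1%Z, 0%Z) (ptY m z) i) ^ 2)
     <= INR m * (/ 2 + kap m) ^ 2).
  { rewrite <- sumR_const. apply sumR_le. intros j Hj. rewrite diff_coord by auto.
    assert (B := offset_bound m z (negb b) j Hm Bz Hj). nra. }
  set (t := z (2 * m)%nat) in *.
  assert (KD : INR m * (/ 2 + kap m) ^ 2 - INR m * (/ 2 - kap m) ^ 2 = / 8)
    by (replace (/ 8) with (2 * (INR m * kap m)) by (rewrite KS; field); field).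
  split; intros T; destruct b; auto; exfalso; cbn [negb] in *; nra.
Qed.

Lemma dK_pos_box m z : (1 <= m)%nat -> box m z -> 0 < dK (S m) (ptX m z) (ptY m z).
Proof.
  intros Hm Bz.
  assert (Hx := ptX_inRn m z). assert (Hy := ptY_inRn m z).
  destruct (dK_nonneg m _ _ Hx Hy) as [L|L]; auto. exfalso.
  destruct (dK_spec m _ _ Hx Hy) as [[[[b v] a] Eg] _].
  assert (M : minimizer m (ptX m z) (ptY m z) (b, v, a)) by (unfold minimizer; auto).
  assert (A0 := minimizer_last m z b v a Hm Bz M). subst a.
  rewrite <- L in Eg. symmetry in Eg. apply euclid_eq0 in Eg; auto using act_inRn.
  assert (Q := f_equal (fun f => f m) Eg). cbv beta in Q.
  assert (Q' := diff_last m z b v 0). rewrite Q in Q' at 1.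
  assert (B := Bz (2 * m)%nat ltac:(lia)). destruct b; lra.
Qed.

Definition vertex (b : bool) (beta : nat -> bool) : deck :=
  (b, fun j => if beta j then 1%Z else 0%Z, 0%Z).

Lemma minimizer_vertex m z g : (1 <= m)%nat -> box m z ->
  minimizer m (ptX m z) (ptY m z) g -> exists b beta,
    (forall j, (m <= j)%nat -> beta j = false) /\ forall w, act m g w = act m (vertex b beta) w.
Proof.
  destruct g as [[b v] a]. intros Hm Bz M.
  (* Bits from [m] on are set to false, so that a vertex is represented by only one function. *)
  exists b, (fun j => andb (Nat.ltb j m) (Z.eqb (v j) 1)). split.
  - intros j Hj. destruct (Nat.ltb_spec j m); auto; lia.
  - intros w. rewrite (minimizer_last m z b v a Hm Bz M). unfold vertex. coords j m; auto.
    destruct (minimizer_bit m z b v a j Hm Bz M H) as [[E|E] _]; rewrite E; auto.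
Qed.

Lemma vertex_inj m b beta b' beta' y :
  (forall j, (m <= j)%nat -> beta j = false) -> (forall j, (m <= j)%nat -> beta' j = false) ->
  act m (vertex b beta) y = act m (vertex b' beta') y -> b = b' /\ beta = beta'.
Proof.
  intros Z Z' E.
  assert (Eb : b = b').
  { assert (Q := f_equal (fun f => f m) E). unfold act, vertex in Q.
    rewrite Nat.ltb_irrefl, Nat.eqb_refl in Q. destruct b, b'; auto; lra. }
  subst b'. split; auto. apply functional_extensionality; intros j.
  destruct (le_lt_dec m j) as [L|L]; [rewrite Z, Z'; auto|].
  assert (Q := f_equal (fun f => f j) E). unfold act, vertex in Q.
  destruct (Nat.ltb_spec j m); [|lia].
  destruct (beta j), (beta' j); auto; destruct b; lra.
Qed.

(* The deck transformations [turnX] and [turnY] identify the point of parameter [z] with that of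
   parameter [turn m z]: this is the monodromy of the circle. *)
Definition turn (m : nat) (z : vec) : vec := fun i =>
  if Nat.ltb i (2 * m) then - z i
  else if Nat.eqb i (2 * m + 1) then z i + 1 else z i.

Definition turnX : deck := (true, fun _ => 1%Z, 0%Z).
Definition turnY : deck := (true, fun _ => 0%Z, 0%Z).

Lemma ptX_turn m z : ptX m (turn m z) = act m turnX (ptX m z).
Proof.
  unfold turnX, turn, ptX. coords j m; auto.
  - destruct (Nat.ltb_spec j (2 * m)), (Nat.ltb_spec (m + j) (2 * m)); try lia. field.
  - destruct (Nat.ltb_spec (2 * m + 1) (2 * m)), (Nat.ltb_spec (2 * m) (2 * m)),
      (Nat.eqb_spec (2 * m + 1) (2 * m + 1)), (Nat.eqb_spec (2 * m) (2 * m + 1)); try lia. field.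
Qed.

Lemma ptY_turn m z : ptY m (turn m z) = act m turnY (ptY m z).
Proof.
  unfold turnY, turn, ptY. coords j m; auto.
  - destruct (Nat.ltb_spec j (2 * m)), (Nat.ltb_spec (m + j) (2 * m)); try lia. field.
  - destruct (Nat.ltb_spec (2 * m + 1) (2 * m)),
      (Nat.eqb_spec (2 * m + 1) (2 * m + 1)); try lia. field.
Qed.

(** The monodromy replaces u by [1 - u] and w by [1 - w], so it keeps the cube and negates every
    bit. *)
Lemma vertex_turn m b beta beta' y : (forall j, (j < m)%nat -> beta' j = negb (beta j)) ->
  act m (vertex b beta') (act m turnY y) = act m turnX (act m (vertex b beta) y).
Proof.
  intros H. unfold vertex, turnX, turnY. coords j m; auto.
  - rewrite H by auto. destruct b, (beta j); cbn; ring.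
  - destruct b; ring.
Qed.

Lemma follows_turn m gam gam' z b beta beta' : (1 <= m)%nat ->
  (forall t, 0 <= t <= 1 -> inRn (S m) (gam t)) ->
  (forall t, 0 <= t <= 1 -> exists k, gam' t = act m k (gam t)) ->
  (forall j, (j < m)%nat -> beta' j = negb (beta j)) ->
  follows m gam (ptX m z) (ptY m z) (vertex b beta) ->
  follows m gam' (ptX m (turn m z)) (ptY m (turn m z)) (vertex b beta').
Proof.
  intros Hm Hin Hk Hb [M F].
  assert (Hx := ptX_inRn m z). assert (Hy := ptY_inRn m z).
  rewrite ptX_turn, ptY_turn. split.
  - unfold minimizer. rewrite (vertex_turn m b beta beta'), euclid_act, dK_act by auto. exact M.
  - intros t Ht. destruct (F t Ht) as [h Eh], (Hk t Ht) as [k Ek].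
    rewrite (vertex_turn m b beta beta'), <- act_seg, dK_act by auto.
    rewrite Ek, dK_act by auto.
    set (r := dK (S m) (ptX m z) (gam t) / dK (S m) (ptX m z) (ptY m z)) in *.
    destruct (act_inv m turnX) as [i Hi], (act_comp m k h) as [l Hl], (act_comp m l i) as [l' Hl'].
    exists l'. rewrite <- Hl'. rewrite (proj1 (Hi _)), <- Hl, <- Eh. reflexivity.
Qed.

Lemma ptX_near m z z' r : (1 <= m)%nat ->
  (forall i, (i <= 2 * m + 1)%nat -> Rabs (z' i - z i) < r) ->
  euclid (S m) (ptX m z) (ptX m z') <= INR (S m) * (2 * r).
Proof.
  intros Hm H. destruct (kap_bounds m Hm) as [K _].
  assert (Hr : 0 < r) by (eapply Rle_lt_trans; [apply Rabs_pos|apply (H 0%nat); lia]).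
  apply euclid_le_max; [lra|]. intros i Hi. unfold ptX.
  destruct (Nat.ltb_spec i m); [|destruct (Nat.eqb_spec i m); [|lia]].
  - assert (A := Rabs_def2 _ _ (H i ltac:(lia))).
    assert (B := Rabs_def2 _ _ (H (m + i)%nat ltac:(lia))). apply Rabs_le. nra.
  - assert (A := Rabs_def2 _ _ (H (2 * m)%nat ltac:(lia))).
    assert (B := Rabs_def2 _ _ (H (2 * m + 1)%nat ltac:(lia))). apply Rabs_le. lra.
Qed.

Lemma ptY_near m z z' r : (1 <= m)%nat ->
  (forall i, (i <= 2 * m + 1)%nat -> Rabs (z' i - z i) < r) ->
  euclid (S m) (ptY m z) (ptY m z') <= INR (S m) * (2 * r).
Proof.
  intros Hm H. destruct (kap_bounds m Hm) as [K _].
  assert (Hr : 0 < r) by (eapply Rle_lt_trans; [apply Rabs_pos|apply (H 0%nat); lia]).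
  apply euclid_le_max; [lra|]. intros i Hi. unfold ptY.
  destruct (Nat.ltb_spec i m); [|destruct (Nat.eqb_spec i m); [|lia]].
  - assert (A := Rabs_def2 _ _ (H i ltac:(lia))).
    assert (B := Rabs_def2 _ _ (H (m + i)%nat ltac:(lia))). apply Rabs_le. nra.
  - assert (B := Rabs_def2 _ _ (H (2 * m + 1)%nat ltac:(lia))). apply Rabs_le. lra.
Qed.

(** * From locally constant choices to labelled grids *)

(** Compactness of an interval by the supremum argument, for a property that survives shrinking of
    the scale. *)
Lemma uniform_scale a b (L : R -> R -> Prop) : a <= b ->
  (forall c l l', 0 < l' <= l -> L c l -> L c l') ->
  (forall c, a <= c <= b -> exists l, 0 < l /\
     forall c', a <= c' <= b -> Rabs (c' - c) < l -> L c' l) ->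
  exists l, 0 < l /\ forall c, a <= c <= b -> L c l.
Proof.
  intros Hab mono loc.
  set (E := fun x => a <= x <= b /\ exists l, 0 < l /\ forall c, a <= c <= x -> L c l).
  assert (Ea : E a).
  { split; [lra|]. destruct (loc a ltac:(lra)) as [l [Hl H]]. exists l. split; auto.
    intros c Hc. apply H; [lra|]. replace (c - a) with 0 by lra. rewrite Rabs_R0; auto. }
  destruct (completeness E) as [s [Us Ls]].
  { exists b. intros x [Hx _]. lra. }
  { exists a; auto. }
  assert (Hs : a <= s <= b).
  { split; [apply Us; auto|]. apply Ls. intros x [Hx _]. lra. }
  destruct (loc s Hs) as [l [Hl H]].
  destruct (classic (exists x, E x /\ s - l < x)) as [[x [[Hx [l1 [Hl1 H1]]] Lx]]|No].
  2:{ exfalso. assert (s <= s - l); [|lra]. apply Ls. intros x Ex.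
      apply Rnot_lt_le. intros Lx. apply No. exists x. auto. }
  assert (Hmin : 0 < Rmin l l1) by (apply Rmin_pos; auto).
  assert (K : forall c, a <= c <= b -> c < s + l -> L c (Rmin l l1)).
  { intros c Hc Lc. destruct (Rle_dec c x) as [Q|Q].
    - apply mono with l1; [split; auto using Rmin_r|]. apply H1; lra.
    - apply mono with l; [split; auto using Rmin_l|]. apply H; auto. apply Rabs_def1; lra. }
  destruct (Rlt_dec b (s + l)) as [Q|Q].
  - exists (Rmin l l1). split; auto. intros c Hc. apply K; lra.
  - exfalso. assert (s + l / 2 <= s); [|lra]. apply Us. split; [lra|].
    exists (Rmin l l1). split; auto. intros c Hc. apply K; lra.
Qed.

Definition near (d : nat) (r : R) (x y : vec) : Prop :=
  forall i, (i < d)%nat -> Rabs (x i - y i) < r.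

Lemma lebesgue_number d (lo hi : vec) (Q : vec -> R -> Prop) :
  (forall i, lo i <= hi i) ->
  (forall x l l', 0 < l' <= l -> Q x l -> Q x l') ->
  (forall x, inRn d x -> (forall i, (i < d)%nat -> lo i <= x i <= hi i) ->
     exists l, 0 < l /\ forall x', inRn d x' -> near d l x' x -> Q x' l) ->
  exists l, 0 < l /\
    forall x, inRn d x -> (forall i, (i < d)%nat -> lo i <= x i <= hi i) -> Q x l.
Proof.
  intros Hlh mono loc.
  (* Asking for [Q] on a whole neighbourhood lets the induction absorb the displacement in the
     coordinate being freed. *)
  set (Q' := fun x l => forall x', inRn d x' -> near d l x' x -> Q x' l).
  assert (T : forall k, (k <= d)%nat -> forall x, inRn d x ->
     (forall i, (i < d)%nat -> lo i <= x i <= hi i) -> exists l, 0 < l /\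
     forall x', (forall i, (i < k)%nat -> lo i <= x' i <= hi i) ->
       (forall i, (k <= i)%nat -> x' i = x i) -> Q' x' l).
  { induction k as [|k IH]; intros Hk x Ix Bx.
    - destruct (loc x Ix Bx) as [l [Hl H]]. exists l. split; auto.
      intros x' _ E. replace x' with x; [exact H|].
      apply functional_extensionality; intros i. symmetry; apply E; lia.
    - destruct (uniform_scale (lo k) (hi k)
        (fun c l => forall x', (forall i, (i < k)%nat -> lo i <= x' i <= hi i) ->
           x' k = c -> (forall i, (k < i)%nat -> x' i = x i) -> Q' x' l)) as [l [Hl H]]; auto.
      + intros c l l' Hl H x' B1 B2 B3 y Iy Ny. apply mono with l; auto.
        apply (H x' B1 B2 B3); auto. intros i Hi. specialize (Ny i Hi). lra.
      + intros c Hc. set (xc := fun i => if Nat.eqb i k then c else x i).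
        destruct (IH ltac:(lia) xc) as [l [Hl H]].
        * intros i Hi. unfold xc. destruct (Nat.eqb_spec i k); [lia|auto].
        * intros i Hi. unfold xc. destruct (Nat.eqb_spec i k); [subst; auto|auto].
        * exists (l / 2). split; [lra|]. intros c' Hc' Ncc x' B1 B2 B3 y Iy Ny.
          apply mono with l; [lra|].
          apply (H (fun i => if Nat.eqb i k then c else x' i)); auto.
          -- intros i Hi. destruct (Nat.eqb_spec i k); [lia|auto].
          -- intros i Hi. unfold xc. destruct (Nat.eqb_spec i k); auto. apply B3; lia.
          -- intros i Hi. specialize (Ny i Hi). destruct (Nat.eqb_spec i k).
             ++ subst i. rewrite B2 in Ny. apply Rabs_def2 in Ny. apply Rabs_def2 in Ncc.
                apply Rabs_def1; lra.
             ++ lra.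
      + exists l. split; auto. intros x' B1 B2. apply (H (x' k)); auto. }
  destruct (T d (le_n d) (fun i => if Nat.ltb i d then lo i else 0)) as [l [Hl H]].
  - intros i Hi. destruct (Nat.ltb_spec i d); [lia|auto].
  - intros i Hi. destruct (Nat.ltb_spec i d); [|lia]. specialize (Hlh i). lra.
  - exists l. split; auto. intros x Ix Bx. apply (H x); auto.
    + intros i Hi. destruct (Nat.ltb_spec i d); [lia|]. apply Ix; auto.
    + intros i Hi. replace (x i - x i) with 0 by lra. rewrite Rabs_R0; auto.
Qed.

(* Radius [2 r] in the third clause: the [r]-balls of two anchors of neighbouring points meet, so
   the anchor of larger radius sees the other one. *)
Definition anchor m (idx : vec -> nat) (c : vec -> bool * (nat -> bool)) (l : R) (x p : vec) :=
  exists r, 0 < r <= / 2 /\ box m p /\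
    (forall z, box m z -> near (2 * m + 2) (2 * r) z p -> idx z = idx p -> c z = c p) /\
    (forall y, box m y -> near (2 * m + 2) l y x -> near (2 * m + 2) r y p).

Lemma anchor_uniform m idx c :
  (forall z, box m z -> exists r, 0 < r /\
     forall z', box m z' -> near (2 * m + 2) r z' z -> idx z' = idx z -> c z' = c z) ->
  exists l, 0 < l /\ forall x, inRn (2 * m + 2) x -> box m x ->
    0 <= x (2 * m + 1)%nat <= 1 -> exists p, anchor m idx c l x p.
Proof.
  intros LC.
  destruct (lebesgue_number (2 * m + 2) (fun i => if Nat.eqb i (2 * m + 1) then 0 else -1)
    (fun _ => 1) (fun x l => exists p, anchor m idx c l x p)) as [l [Hl H]].
  - intros i. destruct (Nat.eqb i (2 * m + 1)); lra.
  - intros x l l' Hl [p [r [Hr [Bp [Cp H]]]]]. exists p, r.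
    refine (conj Hr (conj Bp (conj Cp _))).
    intros y By Ny. apply H; auto. intros i Hi. specialize (Ny i Hi). lra.
  - intros x Ix Bx.
    assert (Bx' : box m x).
    { intros i Hi. specialize (Bx i ltac:(lia)). cbv beta in Bx.
      destruct (Nat.eqb_spec i (2 * m + 1)); [lia|lra]. }
    destruct (LC x Bx') as [r0 [Hr0 C0]].
    (* [r0 / 2] fits the ball of radius [2 * r] into that of radius [r0]; the cap [/ 2] serves
       [anchor_close]. *)
    set (r := Rmin (r0 / 2) (/ 2)).
    assert (Hr : 0 < r) by (apply Rmin_pos; lra).
    assert (R1 := Rmin_l (r0 / 2) (/ 2)). assert (R2 := Rmin_r (r0 / 2) (/ 2)). fold r in R1, R2.
    exists (r / 2). split; [lra|]. intros x' Ix' Nx. exists x, r.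
    refine (conj (conj Hr R2) (conj Bx' (conj _ _))).
    + intros z Bz Nz. apply C0; auto. intros i Hi. specialize (Nz i Hi). lra.
    + intros y By Ny i Hi. specialize (Ny i Hi). specialize (Nx i Hi).
      apply Rabs_def2 in Ny. apply Rabs_def2 in Nx. apply Rabs_def1; lra.
  - exists l. split; auto. intros x Ix Bx Sx. apply H; auto.
    intros i Hi. destruct (Nat.eqb_spec i (2 * m + 1)); [subst; auto|apply Bx; lia].
Qed.

Definition unturn (m : nat) (z : vec) : vec := fun i =>
  if Nat.ltb i (2 * m) then - z i
  else if Nat.eqb i (2 * m + 1) then z i - 1 else z i.

Lemma turnK m z : turn m (unturn m z) = z.
Proof.
  apply functional_extensionality; intros i. unfold turn, unturn.
  destruct (Nat.ltb i (2 * m)); [ring|]. destruct (Nat.eqb i (2 * m + 1)); ring.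
Qed.

Lemma turn_box m z : box m z -> box m (turn m z).
Proof.
  intros B i Hi. specialize (B i Hi). unfold turn.
  destruct (Nat.ltb i (2 * m)); [lra|]. destruct (Nat.eqb_spec i (2 * m + 1)); [lia|lra].
Qed.

Lemma unturn_box m z : box m z -> box m (unturn m z).
Proof.
  intros B i Hi. specialize (B i Hi). unfold unturn.
  destruct (Nat.ltb i (2 * m)); [lra|]. destruct (Nat.eqb_spec i (2 * m + 1)); [lia|lra].
Qed.

Lemma near_turn m d r z w : near d r (turn m z) (turn m w) <-> near d r z w.
Proof.
  assert (E : forall i, Rabs (turn m z i - turn m w i) = Rabs (z i - w i)).
  { intros i. unfold turn. destruct (Nat.ltb i (2 * m)).
    - rewrite Rabs_minus_sym. f_equal. ring.
    - destruct (Nat.eqb i (2 * m + 1)); f_equal; ring. }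
  split; intros H i Hi; [rewrite <- E|rewrite E]; auto.
Qed.

Lemma anchor_turn m idx c l x p :
  (forall z, box m z -> idx (turn m z) = idx z) ->
  (forall z, box m z -> c (turn m z) =
     (fst (c z), fun j => if Nat.ltb j m then negb (snd (c z) j) else false)) ->
  anchor m idx c l x p -> anchor m idx c l (turn m x) (turn m p).
Proof.
  intros Hi Hc [r [Hr [Bp [Cp H]]]]. exists r.
  refine (conj Hr (conj (turn_box m p Bp) (conj _ _))).
  - intros z Bz. rewrite <- (turnK m z). assert (Bu := unturn_box m z Bz).
    rewrite near_turn, !Hi, !Hc by auto. intros N E. rewrite (Cp _ Bu N E). reflexivity.
  - intros y By. rewrite <- (turnK m y). assert (Bu := unturn_box m y By).
    rewrite !near_turn. apply H; auto.
Qed.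

Lemma anchor_consistent m idx c l x y p q : 0 < l -> box m x -> box m y ->
  near (2 * m + 2) l y x -> anchor m idx c l x p -> anchor m idx c l y q ->
  idx p = idx q -> c p = c q.
Proof.
  intros Hl Bx By N [r [Hr [Bp [Cp Ap]]]] [s [Hs [Bq [Cq Aq]]]] E.
  assert (Np := Ap y By N).
  assert (Nq : near (2 * m + 2) s y q).
  { apply Aq; auto. intros i Hi. replace (y i - y i) with 0 by lra. rewrite Rabs_R0; auto. }
  destruct (Rle_dec r s) as [L|L].
  - apply Cq; auto. intros i Hi. specialize (Np i Hi). specialize (Nq i Hi).
    apply Rabs_def2 in Np. apply Rabs_def2 in Nq. apply Rabs_def1; lra.
  - symmetry. apply Cp; auto. intros i Hi. specialize (Np i Hi). specialize (Nq i Hi).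
    apply Rabs_def2 in Np. apply Rabs_def2 in Nq. apply Rabs_def1; lra.
Qed.

Lemma anchor_close m idx c l x p i : 0 < l -> box m x -> anchor m idx c l x p ->
  (i < 2 * m + 2)%nat -> Rabs (x i - p i) < / 2.
Proof.
  intros Hl Bx [r [Hr [Bp [Cp Ap]]]] Hi.
  eapply Rlt_le_trans; [apply (Ap x Bx)|apply Hr]; auto.
  intros j Hj. replace (x j - x j) with 0 by lra. rewrite Rabs_R0; auto.
Qed.

(** * The grid and its anchors *)

Definition rho (m N : nat) (x : nat -> nat) : vec := fun i =>
  if Nat.ltb i (2 * m + 1) then -1 + 2 * INR (x i) / INR N
  else if Nat.eqb i (2 * m + 1) then INR (x i) / INR N else 0.

Definition mir (m N : nat) (x : nat -> nat) : nat -> nat := fun i =>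
  if Nat.ltb i (2 * m) then (N - x i)%nat
  else if Nat.eqb i (2 * m + 1) then 0%nat else x i.

Lemma frac_bounds N k : (0 < N)%nat -> (k <= N)%nat -> 0 <= INR k / INR N <= 1.
Proof.
  intros HN Hk. assert (P : 0 < INR N) by (apply lt_0_INR; auto).
  assert (Q : INR k <= INR N) by (apply le_INR; auto). assert (Z := pos_INR k).
  split.
  - apply Rmult_le_pos; auto. apply Rlt_le, Rinv_0_lt_compat; auto.
  - apply Rmult_le_reg_r with (INR N); auto. field_simplify; lra.
Qed.

Lemma rho_box m N x : (0 < N)%nat -> (forall i, (x i <= N)%nat) -> box m (rho m N x).
Proof.
  intros HN Hx i Hi. unfold rho. destruct (Nat.ltb_spec i (2 * m + 1)); [|lia].
  assert (F := frac_bounds N (x i) HN (Hx i)).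
  replace (2 * INR (x i) / INR N) with (2 * (INR (x i) / INR N)) by (unfold Rdiv; ring). lra.
Qed.

Lemma rho_inRn m N x : inRn (2 * m + 2) (rho m N x).
Proof.
  intros i Hi. unfold rho. destruct (Nat.ltb_spec i (2 * m + 1)); [lia|].
  destruct (Nat.eqb_spec i (2 * m + 1)); [lia|auto].
Qed.

Lemma rho_last m N x : rho m N x (2 * m + 1)%nat = INR (x (2 * m + 1)%nat) / INR N.
Proof. unfold rho. rewrite Nat.ltb_irrefl, Nat.eqb_refl. reflexivity. Qed.

Lemma rho_mir m N x : (0 < N)%nat -> (forall i, (x i <= N)%nat) ->
  x (2 * m + 1)%nat = N -> rho m N x = turn m (rho m N (mir m N x)).
Proof.
  intros HN Hx E. assert (P : INR N <> 0) by (apply not_0_INR; lia).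
  apply functional_extensionality; intros i. unfold turn, rho, mir.
  destruct (Nat.ltb_spec i (2 * m)).
  - destruct (Nat.ltb_spec i (2 * m + 1)); [|lia]. rewrite minus_INR by auto. field; auto.
  - destruct (Nat.eqb_spec i (2 * m + 1)).
    + subst i. rewrite Nat.ltb_irrefl, E. cbn. field; auto.
    + reflexivity.
Qed.

Lemma rho_near m N x y l d : (0 < N)%nat -> 2 / INR N < l ->
  (forall i, (x i <= S (y i))%nat) -> (forall i, (y i <= S (x i))%nat) ->
  near d l (rho m N x) (rho m N y).
Proof.
  intros HN L H1 H2 i _. assert (P : 0 < INR N) by (apply lt_0_INR; auto).
  assert (A := le_INR _ _ (H1 i)). assert (B := le_INR _ _ (H2 i)). rewrite S_INR in A, B.
  assert (I : 0 < / INR N) by (apply Rinv_0_lt_compat; auto).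
  unfold rho, Rdiv in *.
  destruct (Nat.ltb i (2 * m + 1)); [|destruct (Nat.eqb i (2 * m + 1))]; apply Rabs_def1; nra.
Qed.

(** [N] is even, as [J_reflect] requires, and neighbours are closer than [l]. Anchors on the last
    slice are turned from those of the first, so that the gluing condition on labels holds
    exactly. *)
Lemma grid_anchors m idx c :
  (forall z, box m z -> exists r, 0 < r /\
     forall z', box m z' -> near (2 * m + 2) r z' z -> idx z' = idx z -> c z' = c z) ->
  (forall z, box m z -> idx (turn m z) = idx z) ->
  (forall z, box m z -> c (turn m z) =
     (fst (c z), fun j => if Nat.ltb j m then negb (snd (c z) j) else false)) ->
  exists K l (pk : (nat -> nat) -> vec), let N := (2 * S K)%nat in
    0 < l /\ 2 / INR N < l /\
    (forall x, (forall i, (x i <= N)%nat) -> anchor m idx c l (rho m N x) (pk x)) /\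
    (forall x, (forall i, (x i <= N)%nat) -> x (2 * m + 1)%nat = N ->
       pk x = turn m (pk (mir m N x))).
Proof.
  intros LC Ti Tc. destruct (anchor_uniform m idx c LC) as [l [Hl H]].
  destruct (archimed_cor1 l Hl) as [K [LK HK]].
  set (N := (2 * S K)%nat). assert (HN : (0 < N)%nat) by (unfold N; lia).
  set (p0 := fun x => epsilon (inhabits (fun _ => 0)) (anchor m idx c l (rho m N x))).
  assert (P0 : forall x, (forall i, (x i <= N)%nat) -> anchor m idx c l (rho m N x) (p0 x)).
  { intros x Hx. apply epsilon_spec. apply H; auto using rho_inRn, rho_box.
    rewrite rho_last. apply frac_bounds; auto. }
  assert (Hm : forall x, (forall i, (x i <= N)%nat) -> forall i, (mir m N x i <= N)%nat).
  { intros x Hx i. unfold mir. destruct (Nat.ltb i (2 * m)); [lia|].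
    destruct (Nat.eqb i (2 * m + 1)); [lia|auto]. }
  exists K, l, (fun x => if Nat.eqb (x (2 * m + 1)%nat) N then turn m (p0 (mir m N x)) else p0 x).
  cbv zeta. fold N. refine (conj Hl (conj _ (conj _ _))).
  - assert (A : 0 < INR K) by (apply lt_0_INR; auto).
    eapply Rle_lt_trans; [|apply LK]. unfold N. rewrite mult_INR, (S_INR K).
    replace (INR 2) with 2 by (cbn; lra).
    replace (2 / (2 * (INR K + 1))) with (/ (INR K + 1)) by (field; lra).
    apply Rinv_le_contravar; lra.
  - intros x Hx. destruct (Nat.eqb_spec (x (2 * m + 1)%nat) N) as [E|E]; auto.
    rewrite (rho_mir m N x HN Hx E). apply anchor_turn; auto.
  - intros x Hx E. rewrite (proj2 (Nat.eqb_eq _ _) E).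
    destruct (Nat.eqb_spec (mir m N x (2 * m + 1)%nat) N) as [F|F]; auto.
    exfalso. unfold mir in F. destruct (Nat.ltb_spec (2 * m + 1) (2 * m)); [lia|].
    rewrite Nat.eqb_refl in F. lia.
Qed.

Module Bridge.
Import all_boot zify.
Import Comb.
Local Open Scope R_scope.

(** A grid point takes the piece and the vertex of its anchor, so adjacent points with equal labels
    agree. The anchor is within [/ 2] of the point, so on the boundary of the grid it keeps the sign
    of u and w and the side of t that Sperner's conditions ask for. *)
Theorem locally_constant_choice_bound m (idx : vec -> nat) (c : vec -> bool * (nat -> bool)) :
  Peano.le 1 m ->
  (forall z, box m z -> exists r, 0 < r /\ forall z', box m z' ->
     near (Nat.add (Nat.mul 2 m) 2) r z' z -> idx z' = idx z -> c z' = c z) ->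
  (forall z, box m z -> idx (turn m z) = idx z) ->
  (forall z, box m z -> c (turn m z) =
     (fst (c z), fun j => if Nat.ltb j m then negb (snd (c z) j) else false)) ->
  (forall z j, box m z -> Peano.lt j m ->
     let w := z (if fst (c z) then Nat.add m j else j) in
     (0 < w -> snd (c z) j = true) /\ (w < 0 -> snd (c z) j = false)) ->
  (forall z, box m z -> (/ 2 <= z (Nat.mul 2 m) -> fst (c z) = true) /\
     (z (Nat.mul 2 m) <= - / 2 -> fst (c z) = false)) ->
  ~ (forall z, box m z -> Peano.lt (idx z) (Nat.add (Nat.mul 2 m) 2)).
Proof.
move=> Hm LC Ti Tc Cb Cs HK.
have [K [l [pk [Hl [HN [Ha Ht]]]]]] := grid_anchors m idx c LC Ti Tc.
move: HN Ha Ht; move EN : (2 * K.+1)%coq_nat => N HN Ha Ht.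
have N0 : Peano.lt 0 N by lia.
have N1 : (0 < INR N) by apply: lt_0_INR.
have lebox (x : nat -> nat) : (forall i, x i <= N)%N -> forall i, Peano.le (x i) N.
  by move=> H i; apply/leP.
pose lab x : nat * V := (idx (pk x), (fst (c (pk x)), mkseq (snd (c (pk x))) m)).
have anc x : (forall i, x i <= N)%N -> anchor m idx c l (rho m N x) (pk x).
  by move=> /lebox; exact: Ha.
have bx x : (forall i, x i <= N)%N -> box m (rho m N x).
  by move=> /lebox; exact: rho_box.
have pbx x : (forall i, x i <= N)%N -> box m (pk x).
  by move=> /anc [r [_ [H _]]].
have low x i : (forall j, x j <= N)%N -> (i < 2 * m + 1)%N -> x i = 0%N -> (pk x i <= - / 2).
  move=> Hx im xi.
  have A := anchor_close m idx c l _ _ i Hl (bx x Hx) (anc x Hx) ltac:(lia).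
  apply Rabs_def2 in A; move: A; rewrite /rho.
  case: Nat.ltb_spec => [_|]; last by lia.
  have I0 : INR 0 = 0 by [].
  have E : 2 * 0 / INR N = 0 by field; lra.
  by rewrite xi I0 => A; lra.
have high x i : (forall j, x j <= N)%N -> (i < 2 * m + 1)%N -> x i = N -> (/ 2 <= pk x i).
  move=> Hx im xi.
  have A := anchor_close m idx c l _ _ i Hl (bx x Hx) (anc x Hx) ltac:(lia).
  apply Rabs_def2 in A; move: A; rewrite /rho.
  case: Nat.ltb_spec => [_|]; last by lia.
  have E : 2 * INR N / INR N = 2 by field; lra.
  by rewrite xi => A; lra.
have m2 : (2 * m)%coq_nat = m.*2 by lia.
have m21 : ((2 * m)%coq_nat + 1)%coq_nat = m.*2.+1 by lia.
have L : labelling m N lab.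
  split.
  - move=> x y Hx Hy Hxy Hyx E.
    have Ec : c (pk x) = c (pk y).
      apply: (anchor_consistent m idx c l (rho m N x) (rho m N y)) => //.
      + exact: bx. + exact: bx.
      + apply: rho_near => // i; apply/leP; [exact: Hyx|exact: Hxy].
      + exact: anc. + exact: anc.
    by move: E; rewrite /lab /= => ->; rewrite Ec.
  - by move=> x Hx; rewrite /lab /= size_mkseq.
  - move=> x j Hx jm /= E; have jm' : Peano.lt j m by lia.
    have := Cb _ _ (pbx x Hx) jm'; rewrite E /= => -[Cp Cn].
    rewrite nth_mkseq //; split=> xj; [apply: Cn|apply: Cp].
    + have := low x j Hx ltac:(lia) xj; lra.
    + have := high x j Hx ltac:(lia) xj; lra.
  - move=> x j Hx jm /= E; have jm' : Peano.lt j m by lia.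
    have := Cb _ _ (pbx x Hx) jm'; rewrite E /= => -[Cp Cn].
    rewrite nth_mkseq //; split=> xj; [apply: Cn|apply: Cp].
    + have := low x (Nat.add m j) Hx ltac:(lia) xj; lra.
    + have := high x (Nat.add m j) Hx ltac:(lia) xj; lra.
  - move=> x Hx /=; have [Ct Cf] := Cs _ (pbx x Hx).
    split=> xj; [apply: Cf|apply: Ct]; rewrite m2.
    + by apply: low => //; lia.
    + by apply: high => //; lia.
  - move=> x Hx xs; have Ep := Ht x (lebox x Hx); rewrite m21 in Ep.
    have Em : mir m N x = mirror m N x.
      apply: functional_extensionality => i; rewrite /mir /mirror m21 m2.
      by case: Nat.ltb_spec; case: ltnP => //; try lia; case: Nat.eqb_spec; case: eqP.
    have Hmx i : (mirror m N x i <= N)%N.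
      by rewrite /mirror; case: ifP => _; [lia|case: ifP => _; [|exact: Hx]].
    rewrite /lab /flipp /flipv /= (Ep xs) Em Ti ?Tc; try exact: pbx.
    congr (_, (_, _)); rewrite -map_comp; apply/eq_in_map => j; rewrite mem_iota => jm /=.
    by case: Nat.ltb_spec => //; lia.
apply: (labels_lower_bound _ _ L); [lia|by lia|].
move=> x Hx /=; have := HK _ (pbx x Hx); lia.
Qed.

End Bridge.

(** * The lower bound *)

(** A minimum over finitely many bit vectors, by fixing one bit at a time. *)
Lemma finite_bits m (P : (nat -> bool) -> R -> Prop) :
  (forall beta d d', 0 < d' <= d -> P beta d -> P beta d') ->
  (forall beta, exists d, 0 < d /\ P beta d) ->
  exists d, 0 < d /\ forall beta, (forall j, (m <= j)%nat -> beta j = false) -> P beta d.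
Proof.
  intros mono H.
  assert (T : forall k beta, exists d, 0 < d /\
    forall beta', (forall j, (k <= j)%nat -> beta' j = beta j) -> P beta' d).
  { induction k as [|k IH]; intros beta.
    - destruct (H beta) as [d [Hd Pd]]. exists d. split; auto. intros beta' E.
      replace beta' with beta; auto. apply functional_extensionality; intros j.
      symmetry; apply E; lia.
    - destruct (IH (fun j => if Nat.eqb j k then true else beta j)) as [d1 [H1 P1]].
      destruct (IH (fun j => if Nat.eqb j k then false else beta j)) as [d2 [H2 P2]].
      assert (Hmin : 0 < Rmin d1 d2) by (apply Rmin_pos; auto).
      exists (Rmin d1 d2). split; auto. intros beta' E.
      destruct (beta' k) eqn:Ek.
      + apply mono with d1; [split; auto using Rmin_l|]. apply P1. intros j Hj.
        destruct (Nat.eqb_spec j k); [subst; auto|apply E; lia].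
      + apply mono with d2; [split; auto using Rmin_r|]. apply P2. intros j Hj.
        destruct (Nat.eqb_spec j k); [subst; auto|apply E; lia]. }
  destruct (T m (fun _ => false)) as [d [Hd Pd]]. exists d. split; auto.
Qed.

Section Decomposition.
Variables (m k : nat) (E : nat -> vec * vec -> Prop).
Hypotheses (Hm : (1 <= m)%nat) (dec : GC_decomposition (S m) k E).

Definition point (z : vec) : vec * vec := (ptX m z, ptY m z).

Definition piece (z : vec) : nat :=
  epsilon (inhabits O) (fun i => (i <= k)%nat /\ E i (point z)).

Definition sect (i : nat) : vec * vec -> R -> vec :=
  epsilon (inhabits (fun _ _ _ => 0)) (cont_section (S m) (E i)).

Definition chosen (z : vec) (v : bool * (nat -> bool)) : Prop :=
  (forall j, (m <= j)%nat -> snd v j = false) /\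
  follows m (sect (piece z) (point z)) (ptX m z) (ptY m z) (vertex (fst v) (snd v)).

Definition choice (z : vec) : bool * (nat -> bool) :=
  epsilon (inhabits (true, fun _ => false)) (chosen z).

Lemma point_in z : inKK (S m) (point z).
Proof. split; [apply ptX_inRn|apply ptY_inRn]. Qed.

Lemma piece_spec z : (piece z <= k)%nat /\ E (piece z) (point z).
Proof.
  unfold piece. apply epsilon_spec. apply dec. apply point_in.
Qed.

Lemma sect_spec i : (i <= k)%nat -> cont_section (S m) (E i) (sect i).
Proof. intros Hi. unfold sect. apply epsilon_spec. apply dec; auto. Qed.

Lemma sect_geodesic z : min_geod (S m) (sect (piece z) (point z)) /\
  Kequiv (S m) (sect (piece z) (point z) 0) (ptX m z) /\
  Kequiv (S m) (sect (piece z) (point z) 1) (ptY m z).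
Proof.
  destruct (piece_spec z) as [Hk Ez]. destruct (sect_spec _ Hk) as [C _].
  apply (C (point z) (point_in z) Ez).
Qed.

Lemma choice_spec z : box m z -> chosen z (choice z).
Proof.
  intros Bz. unfold choice. apply epsilon_spec.
  destruct (sect_geodesic z) as [G [G0 G1]].
  destruct (follows_exists m (sect (piece z) (point z)) (ptX m z) (ptY m z)) as [g F];
    auto using ptX_inRn, ptY_inRn, dK_pos_box.
  destruct (minimizer_vertex m z g Hm Bz (proj1 F)) as [b [beta [Z Eg]]].
  exists (b, beta). split; auto. exact (follows_act _ _ _ _ _ _ (Eg _) F).
Qed.

Lemma choice_unique z v : box m z -> chosen z v -> v = choice z.
Proof.
  intros Bz [Z F]. destruct (choice_spec z Bz) as [Z' F'].
  destruct (sect_geodesic z) as [G [G0 G1]].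
  assert (Q : act m (vertex (fst v) (snd v)) (ptY m z) =
     act m (vertex (fst (choice z)) (snd (choice z))) (ptY m z)).
  { eapply follows_unique with (x := ptX m z); eauto using ptX_inRn, ptY_inRn, dK_pos_box. }
  apply vertex_inj in Q as [Q1 Q2]; auto.
  destruct v, (choice z); cbn in *; subst; auto.
Qed.

(** There are finitely many other vertices; [not_follows_near] excludes each of them near [z], and a
    common radius serves all. *)
Lemma choice_locally_constant z : box m z -> exists r, 0 < r /\
  forall z', box m z' -> near (2 * m + 2) r z' z -> piece z' = piece z -> choice z' = choice z.
Proof.
  intros Bz. destruct (piece_spec z) as [Hk Ez].
  destruct (choice_spec z Bz) as [Z F].
  assert (H : forall b, exists d, 0 < d /\ forall beta,
    (forall j, (m <= j)%nat -> beta j = false) -> (b, beta) <> choice z ->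
    forall x' y', inRn (S m) x' -> inRn (S m) y' -> E (piece z) (x', y') ->
      euclid (S m) (ptX m z) x' < d -> euclid (S m) (ptY m z) y' < d ->
      ~ follows m (sect (piece z) (x', y')) x' y' (vertex b beta)).
  { intros b. set (P := fun beta d => (forall j, (m <= j)%nat -> beta j = false) ->
      (b, beta) <> choice z ->
      forall x' y', inRn (S m) x' -> inRn (S m) y' -> E (piece z) (x', y') ->
      euclid (S m) (ptX m z) x' < d -> euclid (S m) (ptY m z) y' < d ->
      ~ follows m (sect (piece z) (x', y')) x' y' (vertex b beta)).
    destruct (finite_bits m P) as [d [Hd Pd]].
    - intros beta d d' Hd Pd Zb N x' y' Hx' Hy' E' L1 L2. apply Pd; auto; lra.
    - intros beta.
      destruct (classic ((forall j, (m <= j)%nat -> beta j = false) /\ (b, beta) <> choice z))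
        as [[Zb N]|No].
      + destruct (not_follows_near m (E (piece z)) (sect (piece z)) (ptX m z) (ptY m z)
          (vertex (fst (choice z)) (snd (choice z))) (vertex b beta)) as [d [Hd Pd]];
          auto using ptX_inRn, ptY_inRn, dK_pos_box, sect_spec.
        * intros Q. apply N. apply vertex_inj in Q as [Q1 Q2]; auto.
          destruct (choice z); cbn in *; subst; auto.
        * exists d. split; auto. intros _ _. exact Pd.
      + exists 1. split; [lra|]. intros Zb N. exfalso; auto.
    - exists d. split; auto. intros beta Zb. apply (Pd beta Zb Zb). }
  destruct (H true) as [d1 [Hd1 H1]], (H false) as [d2 [Hd2 H2]].
  set (d := Rmin d1 d2).
  assert (Hd : 0 < d) by (apply Rmin_pos; auto).
  assert (D1 : d <= d1) by apply Rmin_l. assert (D2 : d <= d2) by apply Rmin_r.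
  assert (SP : 0 < INR (S m)) by (apply lt_0_INR; lia).
  (* [ptX] and [ptY] move by at most [2 (m + 1)] times this radius, that is [d / 2]. *)
  exists (d / (4 * INR (S m))). split.
  { apply Rdiv_lt_0_compat; lra. }
  intros z' Bz' N Ep. apply NNPP. intros Ne.
  assert (RE : INR (S m) * (2 * (d / (4 * INR (S m)))) = d / 2) by (field; lra).
  assert (LX := ptX_near m z z' _ Hm (fun i Hi => N i ltac:(lia))).
  assert (LY := ptY_near m z z' _ Hm (fun i Hi => N i ltac:(lia))).
  rewrite RE in LX, LY.
  destruct (piece_spec z') as [_ Ez']. destruct (choice_spec z' Bz') as [Z' F'].
  rewrite Ep in Ez', F'. destruct (choice z') as [[] beta]; cbn [fst snd] in *.
  - apply (H1 beta Z' Ne (ptX m z') (ptY m z')); auto using ptX_inRn, ptY_inRn; lra.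
  - apply (H2 beta Z' Ne (ptX m z') (ptY m z')); auto using ptX_inRn, ptY_inRn; lra.
Qed.

(** Both parameters represent the same point of the product, and the pieces are invariant and
    disjoint. *)
Lemma piece_turn z : piece (turn m z) = piece z.
Proof.
  destruct dec as [Inv [_ [Dis _]]].
  destruct (piece_spec z) as [H1 E1], (piece_spec (turn m z)) as [H2 E2].
  apply (Dis _ _ (point (turn m z))); auto using point_in.
  apply (Inv _ (point z)); auto using point_in; cbn [point fst snd].
  - rewrite ptX_turn. apply act_Kequiv.
  - rewrite ptY_turn. apply act_Kequiv.
Qed.

(** The section takes equivalent values at both representatives, so the negated vertex is followed
    at the turned point; uniqueness of the choice concludes. *)
Lemma choice_turn z : box m z -> choice (turn m z) =
  (fst (choice z), fun j => if Nat.ltb j m then negb (snd (choice z) j) else false).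
Proof.
  intros Bz. symmetry. apply choice_unique; [apply turn_box; auto|].
  destruct (choice_spec z Bz) as [Z F].
  destruct (piece_spec z) as [Hk Ez]. destruct (piece_spec (turn m z)) as [_ Ez'].
  split; cbn [fst snd].
  - intros j Hj. destruct (Nat.ltb_spec j m); auto; lia.
  - rewrite piece_turn in *.
    apply follows_turn with (gam := sect (piece z) (point z)) (beta := snd (choice z)); auto.
    + apply sect_geodesic.
    + intros t Ht. apply (section_class m (E (piece z))); auto using sect_spec, point_in.
      unfold dKK, point. cbn [fst snd]. rewrite ptX_turn, ptY_turn.
      rewrite <- (act_one m (ptX m z)) at 1. rewrite <- (act_one m (ptY m z)) at 1.
      rewrite !dK_act, !dK_refl by auto using ptX_inRn, ptY_inRn. ring.
    + intros j Hj. destruct (Nat.ltb_spec j m); auto; lia.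
Qed.

Lemma pieces_lower_bound : (2 * S m <= k)%nat.
Proof.
  (* If [k < 2 * S m], the [k + 1] pieces supply at most [2 * m + 2] labels. *)
  destruct (le_lt_dec (2 * S m) k) as [L|L]; auto. exfalso.
  apply (Bridge.locally_constant_choice_bound m piece choice Hm).
  - exact choice_locally_constant.
  - intros z _. apply piece_turn.
  - exact choice_turn.
  - intros z j Bz Hj. destruct (choice_spec z Bz) as [_ [M _]].
    destruct (choice z) as [b beta]. cbn [fst snd] in *.
    destruct (minimizer_bit m z b _ _ j Hm Bz M Hj) as [_ [P N]].
    destruct (kap_bounds m Hm) as [K _]. unfold offset in P, N. cbv beta in P, N.
    split; intros W.
    + specialize (P ltac:(nra)). destruct (beta j); [auto|discriminate].
    + specialize (N ltac:(nra)). destruct (beta j); [discriminate|auto].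
  - intros z Bz. destruct (choice_spec z Bz) as [_ [M _]].
    exact (minimizer_side m z _ _ _ Hm Bz M).
  - intros z _. destruct (piece_spec z) as [Hk _]. lia.
Qed.

End Decomposition.

Theorem mainTheorem3 (n : nat) (hn : (2 <= n)%nat)
  (k : nat) (E : nat -> vec * vec -> Prop) :
  GC_decomposition n k E -> (2 * n <= k)%nat.
Proof.
  destruct n as [|m]; [lia|]. apply pieces_lower_bound; lia.
Qed.
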